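(* Consider a finite two-player zero-sum extensive-form game with perfect information and simultaneous moves whose game tree has maximal depth $D$. Let $\epsilon>0$ and let $A$ be an $\epsilon$-Hannan consistent algorithm with guaranteed exploration. Suppose the mean-propagating simultaneous-move Monte Carlo tree search described in the context is run on the (complete) game tree, with both players selecting their actions in every inner state by (separate copies of) $A$, and let $(\hat\sigma_1(t),\hat\sigma_2(t))$ be the behavioral strategy profile given by the empirical frequencies after $t$ simulations. Then for every $\delta>0$ there almost surely exists $t_0\in\mathbb{N}$ such that for all $t\ge t_0$ the profile $(\hat\sigma_1(t),\hat\sigma_2(t))$ is a subgame perfect $(2D^2+\delta)\epsilon$-Nash equilibrium of the game.
   Context: **Game.** The game has a finite set $H$ of inner states and a finite set $Z$ of terminal states forming a tree rooted at the initial state $h_0$. In $h\in H$ player 1 chooses an action $i\in\mathcal A_1(h)=\{1,\dots,m^h\}$ and player 2 simultaneously chooses $j\in\mathcal A_2(h)=\{1,\dots,n^h\}$; the successor is $h_{ij}\in H\cup Z$. In a terminal state $z$ player 1 receives $u_1(z)\in[0,1]$ and player 2 receives $u_2(z)=1-u_1(z)$. The depth $D$ is the maximal number of inner states on a path starting at the root (the root has depth $1$; the deepest inner states, all of whose successors are terminal, have depth $D$). **Strategies and equilibrium.** A behavioral strategy $\sigma_q$ of player $q$ assigns to each $h\in H$ a probability distribution on $\mathcal A_q(h)$. The expected utility (of player 1) is $u(\sigma_1,\sigma_2)=\sum_{z\in Z}\pi^\sigma(z)u_1(z)$, with $\pi^\sigma(z)$ the probability of reaching $z$. A profile is an $\epsilon'$-Nash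 equilibrium if neither player can improve their own expected utility by more than $\epsilon'$ by deviating unilaterally; it is a subgame perfect $\epsilon'$-Nash equilibrium if its restriction to the subgame rooted at $h$ is an $\epsilon'$-Nash equilibrium of that subgame for every $h\in H$. **Hannan consistency.** In a repeated decision problem in which at time $s$ action $i$ would yield payoff $x_i(s)\in[0,1]$ and the player chooses action $i_s$ (receiving $x_{i_s}(s)$), the average regret is $r(t)=\max_i \frac1t\sum_{s=1}^t x_i(s)-\frac1t\sum_{s=1}^t x_{i_s}(s)$. An algorithm for choosing actions is $\epsilon$-Hannan consistent if, for any payoff sequences (e.g. against any opponent strategy; payoffs may be random and depend on the past choices), a player using it has $\limsup_{t\to\infty} r(t)\le\epsilon$ almost surely. When two players with joint action payoff $a_{ij}(s)\in[0,1]$ to player 1 at time $s$ choose $(i_s,j_s)$, player 1's payoffs are $x_i(s)=a_{ij_s}(s)$ and player 2's are $x_j(s)=1-a_{i_sj}(s)$. **Guaranteed exploration.** $A$ is an algorithm with guaranteed exploration if, whenever players 1 and 2 both use $A$ for action selection, the number $t_{ij}$ of times up to time $t$ at which the joint action $(i,j)$ was selected satisfies $\lim_{t\to\infty}t_{ij}=\infty$ almost surely, for every joint action $(i,j)$. **Search procedure.** Every $h\in H$ keeps a reward sum $X_h$ and a visit count $n_h$, both initially $0$, and its own copies of $A$ for each player. One simulation at a state is defined recursively. At a terminal state $z$, return $u_1(z)$. At an inner state $h$: each player's copy of $A$ at $h$ selects an action, giving a joint action $(i,j)$; a simulation is run at $h_{ij}$ and returns a value $x$; set $X_h\leftarrow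 X_h+x$, $n_h\leftarrow n_h+1$; the copies of $A$ at $h$ are updated with payoff $x$ to player 1 and $1-x$ to player 2; return the mean $X_h/n_h$. Thus, from the point of view of the algorithms at $h$, successive visits to $h$ form a repeated game in which the payoff of $(i,j)$ at a given visit is the value that $h_{ij}$ would return if $(i,j)$ were selected at that visit. The procedure runs one simulation from $h_0$ at each time $t=1,2,\dots$; the complete game tree is assumed to be already built. **Empirical frequencies.** For $h\in H$, $\hat\sigma_q(t)$ assigns to an action of player $q$ at $h$ the fraction of the visits to $h$ during the first $t$ simulations in which player $q$ selected that action (arbitrary distribution if $h$ has not been visited). *)

(* Defs.v *)
From HB Require Import structures.
From mathcomp Require Import all_boot all_order all_algebra.
From mathcomp Require Import all_classical all_reals all_analysis.

Set Implicit Arguments.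
Unset Strict Implicit.
Unset Printing Implicit Defensive.

Import Order.TTheory GRing.Theory Num.Theory.

Local Open Scope classical_set_scope.
Local Open Scope ring_scope.

Definition is_distr (R : realType) (T : finType) (p : T -> R) : Prop :=
  (forall x, 0 <= p x) /\ \sum_x p x = 1.

(** * Games *)

Definition child_rel (H Z : finType) (m n : H -> nat)
    (succ : forall h, 'I_(m h) -> 'I_(n h) -> H + Z) : rel H :=
  [rel g h | [exists i, exists j, succ g i j == inl h]].

(* The last four fields say that the states form a tree rooted at [root]:
   the root has no parent, no state is the successor of two different pairs
   (inner state, joint action), and every state is reachable from the root. *)
Record game (R : realType) := Game {
  inner : finType;
  terminal : finType;
  root : inner;
  nact1 : inner -> nat;
  nact2 : inner -> nat;
  nact1_gt0 : forall h, (0 < nact1 h)%N;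
  nact2_gt0 : forall h, (0 < nact2 h)%N;
  succ : forall h, 'I_(nact1 h) -> 'I_(nact2 h) -> inner + terminal;
  u1 : terminal -> R;
  u1_01 : forall z, 0 <= u1 z <= 1;
  succ_neq_root : forall h i j, @succ h i j <> inl root;
  succ_inj : injective
    (fun e : {h : inner & ('I_(nact1 h) * 'I_(nact2 h))%type} =>
       @succ (tag e) (tagged e).1 (tagged e).2);
  inner_reachable : forall h, connect (child_rel succ) root h;
  terminal_reachable : forall z, exists h i j, @succ h i j = inr z
}.

Section GameTheory.
Variables (R : realType) (G : game R).

Definition u2 (z : terminal G) : R := 1 - u1 z.

Definition child : rel (inner G) := child_rel (@succ R G).

(* Paths in the tree are duplicate-free, so they have at most [#|inner G|]
   inner states. *)
Definition depth : nat :=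
  \max_(k < #|inner G| | [exists p : k.-tuple (inner G), path child (root G) p])
    k.+1.

Definition strategy1 (s : forall h : inner G, 'I_(nact1 h) -> R) : Prop :=
  forall h, is_distr (s h).
Definition strategy2 (s : forall h : inner G, 'I_(nact2 h) -> R) : Prop :=
  forall h, is_distr (s h).

Section Utility.
Variables (s1 : forall h : inner G, 'I_(nact1 h) -> R)
          (s2 : forall h : inner G, 'I_(nact2 h) -> R).

(* Probability of reaching [z] from [v]. The recursion goes down the tree; the
   fuel [k] is always taken to be [#|inner G|], which is never exhausted. *)
Fixpoint reach_rec (k : nat) (v : inner G + terminal G) (z : terminal G) : R :=
  match v, k with
  | inr z', _ => (z' == z)%:R
  | inl h, 0%N => 0
  | inl h, k'.+1 =>
      \sum_i \sum_j s1 i * s2 j * reach_rec k' (@succ R G h i j) z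
  end.

Definition reach (h : inner G) (z : terminal G) : R :=
  reach_rec #|inner G| (inl h) z.

(* Expected utility in the subgame rooted at [h]; it depends only on the
   restriction of the profile to the inner states of that subgame. *)
Definition utility (u : terminal G -> R) (h : inner G) : R :=
  \sum_z reach h z * u z.

End Utility.

Definition eps_nash_at (e : R) (h : inner G)
    (s1 : forall h : inner G, 'I_(nact1 h) -> R)
    (s2 : forall h : inner G, 'I_(nact2 h) -> R) : Prop :=
  (forall s1', strategy1 s1' ->
     utility s1' s2 (@u1 R G) h <= utility s1 s2 (@u1 R G) h + e) /\
  (forall s2', strategy2 s2' ->
     utility s1 s2' u2 h <= utility s1 s2 u2 h + e).

Definition subgame_perfect_eps_nash (e : R)
    (s1 : forall h : inner G, 'I_(nact1 h) -> R)
    (s2 : forall h : inner G, 'I_(nact2 h) -> R) : Prop :=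
  [/\ strategy1 s1, strategy2 s2 & forall h, eps_nash_at e h s1 s2].

End GameTheory.

(** * Algorithms *)

(* For each number [m] of actions, a randomized rule giving the law of the next
   action from the past (own action, received payoff) pairs, oldest first. *)
Record algorithm (R : realType) := Algorithm {
  choice_prob :> forall m : nat, seq ('I_m * R) -> 'I_m -> R;
  choice_prob_distr : forall m (l : seq ('I_m * R)),
    (0 < m)%N -> is_distr (choice_prob l)
}.

Definition filtration (d : measure_display) (T : measurableType d)
    (F : nat -> set (set T)) : Prop :=
  [/\ forall s, sigma_algebra setT (F s),
      forall s, F s `<=` measurable &
      forall s t, (s <= t)%N -> F s `<=` F t].

(* [g] is a version of the conditional probability of [E] given [F]. *)
Definition cond_prob (R : realType) (d : measure_display)
    (T : measurableType d) (P : probability T R)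
    (F : set (set T)) (E : set T) (g : T -> R) : Prop :=
  (forall Y : set R, measurable Y -> F (g @^-1` Y)) /\
  (forall B, F B -> P (B `&` E) = (\int[P]_(w in B) (g w)%:E)%E).

(** * Hannan consistency *)

Section Decision.
Variables (R : realType) (A : algorithm R).
Variables (d : measure_display) (T : measurableType d) (P : probability T R).
Variables (m : nat) (x : nat -> T -> 'I_m -> R) (a : nat -> T -> 'I_m).

Definition own_history (t : nat) (w : T) : seq ('I_m * R) :=
  [seq (a s w, x s w (a s w)) | s <- iota 0 t].

(* [F s] is the information available just before the action of time [s] is
   drawn: it contains the past actions and the payoffs up to time [s]
   included (which may thus be random and depend on past actions), and possibly
   more. The draw is made from the law prescribed by [A] using randomness that is
   otherwise independent of [F s]. *)
Definition decision_play (F : nat -> set (set T)) : Prop :=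
  [/\ filtration F,
      forall s w i, 0 <= x s w i <= 1,
      forall s i (Y : set R), measurable Y -> F s [set w | Y (x s w i)],
      forall s i, F s.+1 [set w | a s w = i] &
      forall s i, cond_prob P (F s) [set w | a s w = i]
                    (fun w => A m (own_history s w) i)].

(* The default value [0] of the maximum is harmless: payoffs are nonnegative
   and there is at least one action. *)
Definition regret (t : nat) (w : T) : R :=
  \big[Num.max/0]_(i < m) (t%:R^-1 * \sum_(s < t) x s w i)
  - t%:R^-1 * \sum_(s < t) x s w (a s w).

End Decision.

Definition hannan_consistent (R : realType) (eps : R) (A : algorithm R) : Prop :=
  forall (d : measure_display) (T : measurableType d) (P : probability T R)
         (m : nat) (x : nat -> T -> 'I_m -> R) (a : nat -> T -> 'I_m)
         (F : nat -> set (set T)),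
    decision_play A P x a F ->
    {ae P, forall w, (limn_esup (fun t => (regret x a t w)%:E) <= eps%:E)%E}.

(** * Guaranteed exploration *)

Section SelfPlay.
Variables (R : realType) (A : algorithm R).
Variables (d : measure_display) (T : measurableType d) (P : probability T R).
Variables (m n : nat) (pay : nat -> T -> 'I_m -> 'I_n -> R).
Variables (a : nat -> T -> 'I_m) (b : nat -> T -> 'I_n).

Definition self_play (F : nat -> set (set T)) : Prop :=
  [/\ filtration F,
      forall s w i j, 0 <= pay s w i j <= 1,
      forall s i j (Y : set R), measurable Y -> F s [set w | Y (pay s w i j)],
      forall s i j, F s.+1 [set w | a s w = i /\ b s w = j] &
      forall s i j, cond_prob P (F s) [set w | a s w = i /\ b s w = j]
        (fun w =>
           A m (own_history (fun s w i => pay s w i (b s w)) a s w) i *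
           A n (own_history (fun s w j => 1 - pay s w (a s w) j) b s w) j)].

Definition joint_count (i : 'I_m) (j : 'I_n) (t : nat) (w : T) : nat :=
  count (fun s => (a s w == i) && (b s w == j)) (iota 0 t).

End SelfPlay.

Definition guaranteed_exploration (R : realType) (A : algorithm R) : Prop :=
  forall (d : measure_display) (T : measurableType d) (P : probability T R)
         (m n : nat) (pay : nat -> T -> 'I_m -> 'I_n -> R)
         (a : nat -> T -> 'I_m) (b : nat -> T -> 'I_n)
         (F : nat -> set (set T)),
    self_play A P pay a b F ->
    {ae P, forall w, forall i j, joint_count a b i j t w @[t --> \oo] --> \oo}.

(** * Mean-propagating simultaneous-move Monte Carlo tree search *)

Record node_state (R : realType) (m n : nat) := NodeState {
  reward_sum : R;
  visits : nat;
  hist1 : seq ('I_m * R);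
  hist2 : seq ('I_n * R)
}.

Section Search.
Variables (R : realType) (G : game R).

Definition search_state : Type :=
  forall h : inner G, node_state R (nact1 h) (nact2 h).

Definition init_state : search_state :=
  fun h => NodeState 0 0 [::] [::].

(* A joint action for every inner state. *)
Definition choices : Type :=
  forall h : inner G, ('I_(nact1 h) * 'I_(nact2 h))%type.

Definition update_node (m n : nat) (st : node_state R m n)
    (i : 'I_m) (j : 'I_n) (x : R) : node_state R m n :=
  NodeState (reward_sum st + x) (visits st).+1
            (rcons (hist1 st) (i, x)) (rcons (hist2 st) (j, 1 - x)).

(* One simulation at [v], where [c h] is the joint action selected at [h] if [h]
   is visited: returned value and new state. As for [reach_rec], the fuel
   [#|inner G|] is never exhausted. *)
Fixpoint simulate (k : nat) (c : choices) (S : search_state)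
    (v : inner G + terminal G) : R * search_state :=
  match v, k with
  | inr z, _ => (u1 z, S)
  | inl h, 0%N => (0, S)
  | inl h, k'.+1 =>
      let: (i, j) := c h in
      let: (x, S') := simulate k' c S (succ i j) in
      let: st := update_node (S' h) i j x in
      (reward_sum st / (visits st)%:R, dfwith S' h st)
  end.

(* State after [t] simulations from the root, the simulation number [s]
   (counted from 0) using the selections [c s]. *)
Fixpoint state_after (c : nat -> choices) (t : nat) : search_state :=
  match t with
  | 0%N => init_state
  | t'.+1 =>
      (simulate #|inner G| (c t') (state_after c t') (inl (root G))).2
  end.

(* At each simulation the copies of [A] draw, independently given the past, an
   action at every inner state; the draws at the states that the simulation
   does not visit are discarded without being recorded, so they only serve to
   define what those states would have returned. *)
Definition search_run (A : algorithm R) (d : measure_display)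
    (T : measurableType d) (P : probability T R) (F : nat -> set (set T))
    (c : nat -> T -> choices) : Prop :=
  [/\ filtration F,
      forall s (g : choices), F s.+1 [set w | forall h, c s w h = g h] &
      forall s (g : choices),
        cond_prob P (F s) [set w | forall h, c s w h = g h]
          (fun w => \prod_(h : inner G)
             (A _ (hist1 (state_after (c ^~ w) s h)) (g h).1 *
              A _ (hist2 (state_after (c ^~ w) s h)) (g h).2))].

(* Empirical frequencies; the distribution at unvisited states is arbitrary. *)
Definition empirical1 (S : search_state)
    (s1 : forall h : inner G, 'I_(nact1 h) -> R) : Prop :=
  strategy1 s1 /\
  forall h, (0 < visits (S h))%N -> forall i,
    s1 h i = (count (fun e => e.1 == i) (hist1 (S h)))%:R / (visits (S h))%:R.

Definition empirical2 (S : search_state)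
    (s2 : forall h : inner G, 'I_(nact2 h) -> R) : Prop :=
  strategy2 s2 /\
  forall h, (0 < visits (S h))%N -> forall j,
    s2 h j = (count (fun e => e.1 == j) (hist2 (S h)))%:R / (visits (S h))%:R.

End Search.

(* Main.v *)
(* Visited infinitely often, a state [h] hosts a repeated game: at the random
   time of each visit the copies of [A] at [h] draw independently given the past
   and given the selections made everywhere else during that simulation, which
   fix the payoffs.  As only finitely many selections precede any given time,
   the available information is encoded by an observation with countably many
   values, and the relevant conditional probabilities are computed on its
   fibres.  Guaranteed exploration then propagates infinitely many visits from
   the root to the whole tree, and Hannan consistency bounds all regrets.

   The rest is pathwise.  By backward induction the mean reward of a state at
   distance [d] from the leaves is asymptotically within [d eps] of its value,
   and the empirical frequencies there are within [d eps] of optimal, on either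
   side, around that mean in the matrix game of the successor values.  Summing
   the losses of the two players over the levels gives
   [2 d + 2 * (2 + 4 + ... + 2 (d - 1)) = 2 d ^ 2] times [eps]. *)

Require Import Defs.
From HB Require Import structures.
From mathcomp Require Import all_boot all_order all_algebra.
From mathcomp Require Import all_classical all_reals all_analysis.
From mathcomp Require Import measurable_realfun.
From mathcomp Require Import lra ring zify.

Import Order.TTheory GRing.Theory Num.Theory.
Local Open Scope classical_set_scope.
Local Open Scope ring_scope.

Set Implicit Arguments.
Unset Strict Implicit.
Unset Printing Implicit Defensive.

(** * The game tree *)

Section Tree.
Variables (R : realType) (G : game R).
Implicit Types (g h : inner G) (v : inner G + terminal G).

Lemma childP g h :
  reflect (exists i j, succ (h := g) i j = inl h) (child g h).
Proof.
apply: (iffP existsP) => [[i /existsP[j /eqP e]]|[i [j e]]]; first by exists i, j.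
by exists i; apply/existsP; exists j; apply/eqP.
Qed.

Lemma child_parent_uniq g g' h : child g h -> child g' h -> g = g'.
Proof.
move=> /childP[i [j e]] /childP[i' [j' e']].
have := @succ_inj R G (Tagged _ (i, j)) (Tagged _ (i', j')).
by rewrite /= e e' => /(_ erefl)/(congr1 tag).
Qed.

Lemma child_neq_root g h : child g h -> h != Defs.root G.
Proof.
by move=> /childP[i [j e]]; apply/eqP => hr; move: e; rewrite hr; apply: succ_neq_root.
Qed.

(** Parents are unique and the root has none, so two paths with a common end can be peeled edge by
    edge from that end. This makes [level] independent of the path chosen in it. *)
Lemma path_root_size (p q : seq (inner G)) :
  path (@child R G) (Defs.root G) p -> path (@child R G) (Defs.root G) q ->
  last (Defs.root G) p = last (Defs.root G) q -> size p = size q.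
Proof.
elim/last_ind: p q => [|p x IHp] q.
  case/lastP: q => [//|q y] _; rewrite rcons_path last_rcons => /andP[_ cy] /= e.
  by have := child_neq_root cy; rewrite -e eqxx.
case/lastP: q => [|q y]; rewrite !rcons_path !last_rcons.
  by move=> /andP[_ cx] _ /= e; have := child_neq_root cx; rewrite e eqxx.
move=> /andP[pp cx] /andP[pq cy] e; rewrite -e in cy.
by rewrite !size_rcons (IHp q) //; apply: child_parent_uniq cx cy.
Qed.

Definition level h : nat :=
  size (s2val (cid2 (elimT connectP (inner_reachable h)))).

Lemma levelE (p : seq (inner G)) :
  path (@child R G) (Defs.root G) p -> level (last (Defs.root G) p) = size p.
Proof.
move=> pp; rewrite /level; case: cid2 => /= q pq e.
exact: path_root_size pq pp (esym e).
Qed.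

Lemma level_path h : exists p : seq (inner G),
  [/\ path (@child R G) (Defs.root G) p, last (Defs.root G) p = h & size p = level h].
Proof.
have /connectP[p pp e] := inner_reachable h.
by exists p; split => //; rewrite e levelE.
Qed.

Lemma level_root : level (Defs.root G) = 0%N.
Proof. exact: (@levelE [::]). Qed.

Lemma level_child g h : child g h -> level h = (level g).+1.
Proof.
have [p [pp <- <-]] := level_path g => ch.
have := @levelE (rcons p h); rewrite last_rcons size_rcons; apply.
by rewrite rcons_path pp ch.
Qed.

Lemma level_succ h (i : 'I_(nact1 h)) (j : 'I_(nact2 h)) g :
  succ i j = inl g -> level g = (level h).+1.
Proof. by move=> e; apply/level_child/childP; exists i, j. Qed.

Lemma level_lt_card h : (level h < #|inner G|)%N.
Proof.
have [p [pp <- _]] := level_path h.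
case: (shortenP pp) => q pq uq _.
rewrite levelE //; have /card_uniqP /= <- := uq.
exact: max_card.
Qed.

Lemma level_lt_depth h : (level h < depth G)%N.
Proof.
have [p [pp e s]] := level_path h.
(* [depth] ranges only over path lengths below [#|inner G|]. *)
have := level_lt_card h; rewrite -s => lt.
apply: (@leq_bigmax_cond _ _ (fun k : 'I_#|inner G| => k.+1) (Ordinal lt)).
by apply/existsP; exists (in_tuple p).
Qed.

Lemma depth_gt0 : (0 < depth G)%N.
Proof. exact: leq_ltn_trans (level_lt_depth (Defs.root G)). Qed.

(* Only an upper bound on the depth of the subgame rooted at [v], but it drops
   along every edge, which is all that backward induction needs. *)
Definition codepth v : nat :=
  if v is inl h then (depth G - level h)%N else 0%N.

Lemma codepth_gt0 h : (0 < codepth (inl h))%N.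
Proof. by rewrite /= subn_gt0 level_lt_depth. Qed.

Lemma codepth_succ h (i : 'I_(nact1 h)) (j : 'I_(nact2 h)) :
  (codepth (succ i j) < codepth (inl h))%N.
Proof.
case e: (succ i j) => [g|z]; last exact: codepth_gt0.
rewrite /= (level_succ e); have := level_lt_depth h; lia.
Qed.

Lemma codepth_le_depth v : (codepth v <= depth G)%N.
Proof. by case: v => [h|z] //=; rewrite leq_subr. Qed.

(* Fuel left when the simulation or utility recursion started at the root
   with fuel [#|inner G|] arrives at [h]. *)
Definition fuel h : nat := #|inner G| - level h.

Lemma fuelS h : fuel h = (fuel h).-1.+1.
Proof. by rewrite prednK // subn_gt0 level_lt_card. Qed.

Lemma fuel_succ h (i : 'I_(nact1 h)) (j : 'I_(nact2 h)) g :
  succ i j = inl g -> fuel g = (fuel h).-1.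
Proof. by move=> e; rewrite /fuel (level_succ e) subnS. Qed.

Lemma codepth_le_card h : (codepth (inl h) <= #|inner G|)%N.
Proof.
apply: leq_trans (leq_subr _ _) _; apply/bigmax_leqP => k _.
exact: ltn_ord.
Qed.

End Tree.

(** * Simulations and visits *)

Section Simulation.
Variables (R : realType) (G : game R).
Implicit Types (g h : inner G) (c : choices G) (S : search_state G).

(** An entry of the payoff matrix of the repeated game at [h]: it is defined for every [(i, j)],
    selected or not, and evaluated in the search state [S] preceding the simulation. *)
Definition payoff c S h (i : 'I_(nact1 h)) (j : 'I_(nact2 h)) : R :=
  (simulate (fuel h).-1 c S (succ i j)).1.

Lemma simulate_terminal k c S z : simulate k c S (inr z) = (u1 z, S).
Proof. by case: k. Qed.

Lemma simulate_keep k c S h g :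
  (level g < level h)%N -> (simulate k c S (inl h)).2 g = S g.
Proof.
elim: k h => [|k IHk] h //= lt.
case: (c h) => i j.
case E: (simulate k c S (succ i j)) => [x S'] /=.
rewrite dfwithout; last by apply: contraTneq lt => ->; rewrite ltnn.
rewrite -[S']/((x, S').2) -E; case e: (succ i j) => [h'|z].
  by rewrite IHk // (level_succ e) ltnW.
by rewrite simulate_terminal.
Qed.

Lemma simulate_succ_keep k c S h (i : 'I_(nact1 h)) (j : 'I_(nact2 h)) g :
  (level g <= level h)%N -> (simulate k c S (succ i j)).2 g = S g.
Proof.
move=> le; case e: (succ i j) => [h'|z]; last by rewrite simulate_terminal.
by rewrite simulate_keep // (level_succ e).
Qed.

(** The recursive call runs strictly below [h], so the node of [h] may be read before that call
    instead of after it. *)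
Lemma simulateE k c S h (x := (simulate k c S (succ (c h).1 (c h).2)).1) :
  simulate k.+1 c S (inl h) =
  ((reward_sum (S h) + x) / (visits (S h)).+1%:R,
   dfwith (simulate k c S (succ (c h).1 (c h).2)).2 h
     (update_node (S h) (c h).1 (c h).2 x)).
Proof.
rewrite {}/x /=; case Ec: (c h) => [i j] /=.
have := simulate_succ_keep k c S i j (leqnn (level h)).
by case: (simulate k c S (succ i j)) => [x S'] /= ->.
Qed.

Lemma simulate_root_node c S h (S' := (simulate (fuel h) c S (inl h)).2) :
  S' h = update_node (S h) (c h).1 (c h).2 (payoff c S (c h).1 (c h).2).
Proof. by rewrite {}/S' fuelS simulateE /= dfwithin. Qed.

(** A simulation follows one branch and updates each state on it once. The fuel equation makes the
    fuel left on arrival at [h] agree with the one in [payoff]. *)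
Lemma simulate_node k c S h0 h (S' := (simulate k c S (inl h0)).2) :
  k = fuel h0 ->
  S' h = S h \/
  S' h = update_node (S h) (c h).1 (c h).2 (payoff c S (c h).1 (c h).2) /\
  forall g, succ (c h).1 (c h).2 = inl g -> visits (S' g) = (visits (S g)).+1.
Proof.
rewrite {}/S'; elim: k h0 => [|k IHk] h0 ek; first by left.
have [->|nh] := eqVneq h h0.
  right; split; first by rewrite ek simulate_root_node.
  move=> g eg; rewrite simulateE /= dfwithout; last first.
    by apply/eqP => E; have := level_succ eg; rewrite E; lia.
  have -> : k = fuel g by rewrite (fuel_succ eg) -ek.
  by rewrite eg simulate_root_node.
rewrite simulateE /= dfwithout 1?eq_sym //.
case e: (succ (c h0).1 (c h0).2) => [h'|z]; last by left; rewrite simulate_terminal.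
have ek' : k = fuel h' by rewrite (fuel_succ e) -ek.
have [->|[-> vis]] := IHk h' ek'; [by left|right; split => // g eg].
have [E|ng] := eqVneq g h0; last by rewrite dfwithout 1?eq_sym // vis.
have := vis _ eg; rewrite E simulate_keep; first lia.
by rewrite (level_succ e).
Qed.

Lemma simulate_off k c c' S h h0 :
  (forall g, g != h -> c g = c' g) -> (level h < level h0)%N ->
  simulate k c S (inl h0) = simulate k c' S (inl h0).
Proof.
move=> cc'; elim: k h0 => [//|k IHk] h0 lt.
rewrite !simulateE cc'; last by apply: contraTneq lt => ->; rewrite ltnn.
case e: (succ (c' h0).1 (c' h0).2) => [h'|z]; last by rewrite !simulate_terminal.
by rewrite IHk // (level_succ e) ltnW.
Qed.

(** Below [h] the selection at [h] is never consulted. Hence the payoff matrix of a visit is fixed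
    before the action at [h] is drawn, as [decision_play] and [self_play] demand. *)
Lemma payoff_off c c' S h (i : 'I_(nact1 h)) (j : 'I_(nact2 h)) :
  (forall g, g != h -> c g = c' g) -> payoff c S i j = payoff c' S i j.
Proof.
move=> cc'; rewrite /payoff; case e: (succ i j) => [h'|z].
  by rewrite (simulate_off _ _ cc') // (level_succ e).
by rewrite !simulate_terminal.
Qed.

Lemma visits_off k c c' S h v :
  (forall g, g != h -> c g = c' g) ->
  visits ((simulate k c S v).2 h) = visits ((simulate k c' S v).2 h).
Proof.
move=> cc'; elim: k v => [|k IHk] [h0|z] //.
rewrite !simulateE /=; have [<-|nh] := eqVneq h0 h; first by rewrite !dfwithin.
by rewrite !dfwithout // cc'.
Qed.

Definition rewards_bounded S := forall h, 0 <= reward_sum (S h) <= (visits (S h))%:R.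

Lemma simulate_bounded k c S v :
  rewards_bounded S -> 0 <= (simulate k c S v).1 <= 1 /\ rewards_bounded (simulate k c S v).2.
Proof.
elim: k v => [|k IHk] [h|z] bS; rewrite ?simulate_terminal; try by rewrite ?u1_01.
  by rewrite /= lexx ler01.
have [/andP[x0 x1] bS'] := IHk (succ (c h).1 (c h).2) bS.
rewrite simulateE /=.
have /andP[r0 r1] := bS h.
have b : 0 <= reward_sum (S h) + (simulate k c S (succ (c h).1 (c h).2)).1 <=
   (visits (S h)).+1%:R.
  by rewrite addr_ge0 //= -natr1 lerD.
have /andP[b0 b1] := b.
split.
  by rewrite divr_ge0 //= ler_pdivrMr ?ltr0Sn // mul1r.
move=> g; have [<-|ng] := eqVneq h g; first by rewrite dfwithin.
by rewrite dfwithout.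
Qed.

End Simulation.

(** * Visit counts, visit times and recorded histories *)

Section Visits.
Variables (R : realType) (G : game R).
Implicit Types (h : inner G) (c : nat -> choices G).

Lemma state_after_eq c c' t :
  (forall r, (r < t)%N -> c r = c' r) -> state_after c t = state_after c' t.
Proof.
elim: t => [//|t IHt] cc' /=; rewrite IHt ?cc' // => r lt.
by rewrite cc' // ltnW.
Qed.

Lemma state_after_bounded c t : rewards_bounded (state_after c t).
Proof.
elim: t => [|t IHt] /=; first by move=> h /=; rewrite lexx.
by have [] := simulate_bounded #|inner G| (c t) (inl (Defs.root G)) IHt.
Qed.

Lemma payoff_01 c t (c0 : choices G) h (i : 'I_(nact1 h)) (j : 'I_(nact2 h)) :
  0 <= payoff c0 (state_after c t) i j <= 1.
Proof.
by have [] := simulate_bounded (fuel h).-1 c0 (succ i j) (state_after_bounded c t).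
Qed.

Definition nvisits c t h : nat := visits (state_after c t h).

Lemma state_step c t h (S := state_after c t) (S' := state_after c t.+1) :
  S' h = S h \/
  S' h = update_node (S h) (c t h).1 (c t h).2
           (payoff (c t) S (c t h).1 (c t h).2) /\
  forall g, succ (c t h).1 (c t h).2 = inl g -> nvisits c t.+1 g = (nvisits c t g).+1.
Proof.
by apply: (@simulate_node R G _ _ _ (Defs.root G)); rewrite /fuel level_root subn0.
Qed.

Lemma nvisits_root c t : nvisits c t (Defs.root G) = t.
Proof.
elim: t => [//|t IHt]; rewrite -{2}IHt /nvisits /=.
have -> : #|inner G| = fuel (Defs.root G) by rewrite /fuel level_root subn0.
by rewrite simulate_root_node.
Qed.

Lemma nvisits_step c t h :
  nvisits c t.+1 h = nvisits c t h \/ nvisits c t.+1 h = (nvisits c t h).+1.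
Proof. by rewrite /nvisits; have [->|[-> _]] := state_step c t h; [left|right]. Qed.

Lemma nvisits_mono c h s t : (s <= t)%N -> (nvisits c s h <= nvisits c t h)%N.
Proof.
move=> /subnK <-; elim: (t - s)%N => [//|n IHn]; rewrite addSn.
by apply: leq_trans IHn _; have [->|->] := nvisits_step c (n + s) h.
Qed.

Definition visited_io c h := forall k, exists t, (k < nvisits c t.+1 h)%N.

(* Time of the visit number [k] (counted from 0); [0] if there is none. *)
Definition visit_time c h k : nat :=
  if pselect (exists t, (k < nvisits c t.+1 h)%N) is left e then ex_minn e else 0%N.

Lemma visit_timeP c h k : visited_io c h ->
  nvisits c (visit_time c h k) h = k /\ nvisits c (visit_time c h k).+1 h = k.+1.
Proof.
move=> io; rewrite /visit_time; case: pselect => [e|/(_ (io k))//].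
case: ex_minnP => t lt tmin.
have le : (nvisits c t h <= k)%N.
  rewrite leqNgt; apply/negP; case: t {lt} tmin => [//|t] tmin lt.
  by have := tmin _ lt; rewrite ltnn.
by have [E|E] := nvisits_step c t h; lia.
Qed.

Lemma visit_time_uniq c h k t :
  nvisits c t h = k -> nvisits c t.+1 h = k.+1 -> visit_time c h k = t.
Proof.
move=> Vt VSt; have ex : exists t, (k < nvisits c t.+1 h)%N by exists t; rewrite VSt.
rewrite /visit_time; case: pselect => [e|//].
case: ex_minnP => s lt smin.
have le := smin t; rewrite VSt ltnSn in le.
have := le isT; rewrite leq_eqVlt => /predU1P[//|st].
by have := nvisits_mono c h st; rewrite Vt; lia.
Qed.

Lemma visit_time_ltS c h k : visited_io c h ->
  (visit_time c h k < visit_time c h k.+1)%N.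
Proof.
move=> io; have [e _] := visit_timeP k io; have [e' _] := visit_timeP k.+1 io.
rewrite ltnNge; apply/negP => /(nvisits_mono c h); lia.
Qed.

Lemma iota_rcons n : iota 0 n.+1 = rcons (iota 0 n) n.
Proof. by rewrite -addn1 iotaD cats1. Qed.

Definition visit_choice c h k := c (visit_time c h k) h.

Definition visit_payoff c h k (i : 'I_(nact1 h)) (j : 'I_(nact2 h)) : R :=
  payoff (c (visit_time c h k)) (state_after c (visit_time c h k)) i j.

Definition visit_reward c h k : R :=
  visit_payoff c k (visit_choice c h k).1 (visit_choice c h k).2.

(** Passage from search time to visit numbers: what [A] reads at the node is the history of the
    repeated game indexed by visits. *)
Lemma node_history c t h (n := nvisits c t h) (st := state_after c t h) :
  [/\ hist1 st = [seq ((visit_choice c h k).1, visit_reward c h k) | k <- iota 0 n],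
      hist2 st = [seq ((visit_choice c h k).2, 1 - visit_reward c h k) | k <- iota 0 n]
    & reward_sum st = \sum_(k < n) visit_reward c h k].
Proof.
rewrite {}/n {}/st; elim: t => [|t [IH1 IH2 IH3]].
  by rewrite /nvisits /= big_ord0.
have [E|[E _]] := state_step c t h; first by rewrite /nvisits E.
have EV : nvisits c t.+1 h = (nvisits c t h).+1 by rewrite /nvisits E.
have Et := visit_time_uniq erefl EV.
rewrite EV big_ord_recr !iota_rcons !map_rcons E /= IH1 IH2 IH3.
by rewrite /visit_reward /visit_payoff /visit_choice Et.
Qed.

Lemma nvisits_child c t h (i : 'I_(nact1 h)) (j : 'I_(nact2 h)) g :
  succ i j = inl g ->
  (count (fun k => visit_choice c h k == (i, j)) (iota 0 (nvisits c t h))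
     <= nvisits c t g)%N.
Proof.
move=> e; elim: t => [//|t IHt].
have [E|[E vis]] := state_step c t h.
  by rewrite /nvisits E; apply: leq_trans IHt (nvisits_mono _ _ (leqnSn t)).
have EV : nvisits c t.+1 h = (nvisits c t h).+1 by rewrite /nvisits E.
have Et := visit_time_uniq erefl EV.
rewrite EV iota_rcons -cats1 count_cat /= addn0 {2}/visit_choice Et.
case: eqP => [Ec|_] /=; last first.
  by rewrite addn0; apply: leq_trans IHt (nvisits_mono _ _ (leqnSn t)).
by rewrite vis ?Ec // addn1.
Qed.

End Visits.

(** * Values and approximate equilibria *)

Section MatrixGame.
Variable R : realType.

Lemma distr_sum_le (T : finType) (p f : T -> R) (a : R) :
  is_distr p -> (forall x, f x <= a) -> \sum_x p x * f x <= a.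
Proof.
move=> [p0 p1] fa; rewrite -[leRHS]mul1r -p1 mulr_suml.
by apply: ler_sum => x _; rewrite ler_wpM2l.
Qed.

Lemma distr_sum_ge (T : finType) (p f : T -> R) (a : R) :
  is_distr p -> (forall x, a <= f x) -> a <= \sum_x p x * f x.
Proof.
move=> [p0 p1] fa; rewrite -[leLHS]mul1r -p1 mulr_suml.
by apply: ler_sum => x _; rewrite ler_wpM2l.
Qed.

Lemma dirac_distr (T : finType) (x0 : T) : is_distr (fun x => (x == x0)%:R : R).
Proof.
split=> [x|]; first by rewrite ler0n.
by rewrite (bigD1 x0) //= eqxx big1 ?addr0 // => x /negPf ->.
Qed.

(** In best-reply form, [a] is at most the minimax and at least the maximin of the matrix game. *)
Definition is_value m n (M : 'I_m -> 'I_n -> R) (a : R) : Prop :=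
  (forall q, is_distr q -> exists i, a <= \sum_j q j * M i j) /\
  (forall p, is_distr p -> exists j, \sum_i p i * M i j <= a).

(* Only weak duality is used: the value is the infimum over the mixed actions
   of player 2 of the best response payoff of player 1. *)
Lemma value_exists m n (M : 'I_m -> 'I_n -> R) :
  (0 < m)%N -> (0 < n)%N -> exists a, is_value M a.
Proof.
move=> m0 n0; pose i0 := Ordinal m0; pose j0 := Ordinal n0.
pose E : set R :=
  [set x | exists2 q, is_distr q & forall i, \sum_j q j * M i j <= x].
(* Exchanging the two sums, a payoff that [p] guarantees is at most any level that some [q]
   enforces. *)
have lbE p b : is_distr p -> (forall j, b <= \sum_i p i * M i j) -> lbound E b.
  move=> dp bp x [q dq qx]; apply: le_trans (_ : \sum_i p i * (\sum_j q j * M i j) <= x).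
    have -> : \sum_i p i * (\sum_j q j * M i j) = \sum_j q j * (\sum_i p i * M i j).
      under eq_bigr do rewrite mulr_sumr; rewrite exchange_big /=.
      by apply: eq_bigr => j _; rewrite mulr_sumr; apply: eq_bigr => i _; rewrite mulrCA.
    exact: distr_sum_ge.
  exact: distr_sum_le.
have inE q : is_distr q -> exists i, E (\sum_j q j * M i j).
  move=> dq; have [i _ imax] := @arg_maxP _ R _ i0 predT (fun i => \sum_j q j * M i j) isT.
  by exists i, q => // i'; apply: imax.
have minj p : exists j, forall j', \sum_i p i * M i j <= \sum_i p i * M i j'.
  have [j _ jmin] := @arg_minP _ R _ j0 predT (fun j => \sum_i p i * M i j) isT.
  by exists j => j'; apply: jmin.
have hlb : has_lbound E.
  have [j jmin] := minj (fun i => (i == i0)%:R); eexists.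
  exact: lbE (dirac_distr i0) jmin.
exists (inf E); split=> [q dq|p dp].
  by have [i Ei] := inE q dq; exists i; apply: ge_inf.
have [j jmin] := minj p; exists j; apply: lb_le_inf; last exact: lbE jmin.
by have [i Ei] := inE _ (dirac_distr j0); eexists; exact: Ei.
Qed.

End MatrixGame.

(** * Values of states by backward induction *)

Section GameValue.
Variables (R : realType) (G : game R).
Implicit Types (h : inner G) (v : inner G + terminal G).

Fixpoint value_rec (k : nat) v : R :=
  match v, k with
  | inr z, _ => u1 z
  | inl h, 0%N => 0
  | inl h, k'.+1 =>
      sval (cid (value_exists (fun i j => value_rec k' (@succ R G h i j))
                   (nact1_gt0 h) (nact2_gt0 h)))
  end.

Definition value v : R :=
  match v with inl h => value_rec (fuel h) v | inr z => u1 z end.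

Lemma value_is_value h : is_value (fun i j => value (@succ R G h i j)) (value (inl h)).
Proof.
rewrite /value fuelS /=; case: cid => a /=.
congr is_value; apply/funext => i; apply/funext => j.
case e: (succ i j) => [g|z]; first by rewrite (fuel_succ e).
by case: (fuel h).-1.
Qed.

End GameValue.

(** * From bounds at each state to subgame perfection *)

Section Nash.
Variables (R : realType) (G : game R).
Implicit Types (h : inner G) (v : inner G + terminal G).

Section Payoff.
Variables (s1 : forall h : inner G, 'I_(nact1 h) -> R)
          (s2 : forall h : inner G, 'I_(nact2 h) -> R).

Definition expected (u : terminal G -> R) k v : R :=
  \sum_z reach_rec s1 s2 k v z * u z.

Lemma expected_terminal u k z : expected u k (inr z) = u z.
Proof.
rewrite /expected (bigD1 z) //= big1 => [|z' /negPf nz].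
  by case: k => /=; rewrite eqxx mul1r addr0.
by case: k => /=; rewrite eq_sym nz mul0r.
Qed.

Lemma expectedS u k h : expected u k.+1 (inl h) =
  \sum_i s1 i * (\sum_j s2 j * expected u k (@succ R G h i j)).
Proof.
rewrite /expected /=.
under eq_bigr do rewrite mulr_suml; rewrite exchange_big; apply: eq_bigr => i _.
under eq_bigr do rewrite mulr_suml; rewrite exchange_big mulr_sumr.
apply: eq_bigr => j _; rewrite !mulr_sumr; apply: eq_bigr => z _.
by rewrite !mulrA.
Qed.

Lemma expected_u2 k v : strategy1 s1 -> strategy2 s2 -> (codepth v <= k)%N ->
  expected (@u2 R G) k v = 1 - expected (@u1 R G) k v.
Proof.
move=> d1 d2; elim: k v => [|k IHk] [h|z] le; rewrite ?expected_terminal //.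
  by have := codepth_gt0 h; rewrite lt0n; move: le; rewrite leqn0 => /eqP ->.
have [_ e1] := d1 h; have [_ e2] := d2 h.
rewrite !expectedS -[1 in RHS]e1 -sumrB; apply: eq_bigr => i _.
rewrite -[X in X - _]mulr1 -mulrBr -[1 in RHS]e2 -sumrB; congr (_ * _).
apply: eq_bigr => j _; rewrite IHk ?mulrBr ?mulr1 //.
by have := codepth_succ i j; move: le; lia.
Qed.

End Payoff.

Variables (s1 : forall h : inner G, 'I_(nact1 h) -> R)
          (s2 : forall h : inner G, 'I_(nact2 h) -> R).
Hypotheses (d1 : strategy1 s1) (d2 : strategy2 s2).
Variables (eps eta : R) (mean : inner G -> R).
Hypotheses (eps0 : 0 <= eps) (eta0 : 0 <= eta).
(** At codepth [d] the payoffs approach the values up to [(d - 1) eps] and the regret adds [eps];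
    [eta] stands for the vanishing error terms. *)
Let slack h : R := (codepth (inl h))%:R * eps + eta.
Hypothesis mean_ge : forall h i,
  \sum_j s2 j * value (@succ R G h i j) <= mean h + slack h.
Hypothesis mean_le : forall h j,
  mean h - slack h <= \sum_i s1 i * value (@succ R G h i j).

Lemma mean_le_value h : mean h <= value (inl h) + slack h.
Proof.
have [_ /(_ _ (d1 h))[j lej]] := value_is_value h.
by rewrite -lerBlDr; apply: le_trans lej; exact: mean_le.
Qed.

Lemma value_le_mean h : value (inl h) - slack h <= mean h.
Proof.
have [/(_ _ (d2 h))[i lei] _] := value_is_value h.
by rewrite lerBlDr; apply: le_trans lei _; exact: mean_ge.
Qed.

(* Each level of the subgame at codepth [d] loses at most [2 (d eps + eta)],
   and these losses sum to [d (d + 1) eps + 2 d eta]. *)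
Let loss (d : nat) : R := d%:R * (d%:R + 1) * eps + 2 * d%:R * eta.

Let loss_mono d d' : (d <= d')%N -> loss d <= loss d'.
Proof.
move=> le; have le' : (d%:R : R) <= d'%:R by rewrite ler_nat.
have d0 : (0 : R) <= d%:R by rewrite ler0n.
rewrite /loss; apply: lerD; last by rewrite ler_wpM2r // ler_wpM2l.
by rewrite ler_wpM2r // ler_pM // ?addr_ge0 // lerD2r.
Qed.

Let loss_codepth h : loss (codepth (inl h)) =
  loss (codepth (inl h)).-1 + 2 * slack h.
Proof.
rewrite /slack; case: (codepth (inl h)) (codepth_gt0 h) => // d _ /=.
by rewrite /loss -natr1; ring.
Qed.

Let loss_succ h i j : loss (codepth (@succ R G h i j)) <= loss (codepth (inl h)).-1.
Proof. by apply: loss_mono; have := codepth_succ i j; lia. Qed.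

(** Kept apart from the comparison with the value: passing through [mean h] costs one slack,
    reaching [value] costs two. The final estimate uses the cheaper form at the root of the
    subgame. *)
Lemma expected_le_mean s1' k h :
  (forall v, (codepth v <= k)%N ->
     expected s1' s2 (@u1 R G) k v <= value v + loss (codepth v)) ->
  strategy1 s1' -> (codepth (inl h) <= k.+1)%N ->
  expected s1' s2 (@u1 R G) k.+1 (inl h) <=
    mean h + slack h + loss (codepth (inl h)).-1.
Proof.
move=> IHk d1' le; rewrite expectedS; apply: distr_sum_le (d1' h) _ => i.
apply: le_trans (_ : \sum_j s2 j * (value (succ i j) + loss (codepth (inl h)).-1) <= _).
  apply: ler_sum => j _; rewrite ler_wpM2l //; first by have [] := d2 h.
  apply: le_trans (IHk _ _) _; first by have := codepth_succ i j; lia.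
  by rewrite lerD2l.
under eq_bigr do rewrite mulrDr; rewrite big_split /= -mulr_suml.
by have [_ ->] := d2 h; rewrite mul1r lerD2r; exact: mean_ge.
Qed.

Lemma expected_le_value s1' k v : strategy1 s1' -> (codepth v <= k)%N ->
  expected s1' s2 (@u1 R G) k v <= value v + loss (codepth v).
Proof.
move=> d1'; elim: k v => [|k IHk] [h|z] le; rewrite ?expected_terminal;
  try by rewrite /loss /= !(mulr0, mul0r) !addr0.
  by have := codepth_gt0 h; lia.
apply: le_trans (expected_le_mean IHk d1' le) _.
by rewrite loss_codepth; have := mean_le_value h; lra.
Qed.

Lemma expected_ge_mean s2' k h :
  (forall v, (codepth v <= k)%N ->
     value v - loss (codepth v) <= expected s1 s2' (@u1 R G) k v) ->
  strategy2 s2' -> (codepth (inl h) <= k.+1)%N ->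
  mean h - slack h - loss (codepth (inl h)).-1 <=
    expected s1 s2' (@u1 R G) k.+1 (inl h).
Proof.
move=> IHk d2' le; rewrite expectedS.
(* The mixture of player 2 is put outermost, so that [mean_le] applies to each pure action [j]. *)
have -> : \sum_i s1 i * (\sum_j s2' h j * expected s1 s2' (@u1 R G) k (@succ R G h i j)) =
   \sum_j s2' h j * (\sum_i s1 i * expected s1 s2' (@u1 R G) k (@succ R G h i j)).
  under eq_bigr do rewrite mulr_sumr; rewrite exchange_big /=.
  by apply: eq_bigr => j _; rewrite mulr_sumr; apply: eq_bigr => i _; rewrite mulrCA.
apply: distr_sum_ge (d2' h) _ => j.
apply: le_trans (_ : _ <= \sum_i s1 i * (value (succ i j) - loss (codepth (inl h)).-1)) _.
  under eq_bigr do rewrite mulrBr; rewrite sumrB /= -mulr_suml.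
  by have [_ ->] := d1 h; rewrite mul1r lerD2r; exact: mean_le.
apply: ler_sum => i _; rewrite ler_wpM2l //; first by have [] := d1 h.
apply: le_trans (IHk _ _); first by rewrite lerD2l lerN2.
by have := codepth_succ i j; lia.
Qed.

Lemma expected_ge_value s2' k v : strategy2 s2' -> (codepth v <= k)%N ->
  value v - loss (codepth v) <= expected s1 s2' (@u1 R G) k v.
Proof.
move=> d2'; elim: k v => [|k IHk] [h|z] le; rewrite ?expected_terminal;
  try by rewrite /loss /= !(mulr0, mul0r) !addr0 subr0.
  by have := codepth_gt0 h; lia.
apply: le_trans (expected_ge_mean IHk d2' le).
by rewrite loss_codepth; have := value_le_mean h; lra.
Qed.

Lemma subgame_perfect_of_mean (D := (depth G)%:R : R) :
  subgame_perfect_eps_nash (2 * D ^+ 2 * eps + 4 * D * eta) s1 s2.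
Proof.
(* One inequality serves both players: [s2' = s2] bounds the deviations of player 1, and [s1' = s1]
   those of player 2, whose utility is [1 - u1]. *)
have gap s1' s2' h : strategy1 s1' -> strategy2 s2' ->
    utility s1' s2 (@u1 R G) h <=
    utility s1 s2' (@u1 R G) h + (2 * D ^+ 2 * eps + 4 * D * eta).
  move=> d1' d2'; rewrite /utility -/(expected s1' s2 _ _ _) -/(expected s1 s2' _ _ _).
  have := codepth_le_card h; case: (#|inner G|) => [|k] le.
    by have := codepth_gt0 h; lia.
  have := expected_le_mean (fun v => @expected_le_value s1' k v d1') d1' le.
  have := expected_ge_mean (fun v => @expected_ge_value s2' k v d2') d2' le.
  (* At codepth [d + 1] the coefficient of [eps] is [2 (d + 1) + 2 d (d + 1) = 2 (d + 1) ^ 2], and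
     that of [eta] is [2 + 4 d], at most [4 D]. *)
  have : 2 * slack h + 2 * loss (codepth (inl h)).-1 <= 2 * D ^+ 2 * eps + 4 * D * eta.
    rewrite /slack; have := codepth_le_depth (inl h).
    case: (codepth (inl h)) (codepth_gt0 h) => // d _.
    rewrite -(ler_nat R) -/D -natr1 /loss [_.+1.-1]/= => led.
    have d0 : (0 : R) <= d%:R by rewrite ler0n.
    have : (d%:R + 1) ^+ 2 * eps <= D ^+ 2 * eps.
      by rewrite ler_wpM2r // ler_sqr ?nnegrE ?addr_ge0 // ler0n.
    have : (d%:R + 1) * eta <= D * eta by rewrite ler_wpM2r.
    by have := eta0; lra.
  by move: (slack h) (loss _) (mean h) => a b c'; lra.
split=> // h; split=> [s1' d1'|s2' d2']; first exact: gap.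
rewrite /utility -!/(expected _ _ _ _ _) !expected_u2 //; try exact: codepth_le_card.
by have := gap s1 s2' h d1 d2'; rewrite /utility -!/(expected _ _ _ _ _); lra.
Qed.

End Nash.

(** * Pathwise convergence *)

Section Asymptotics.
Variables (R : realType) (G : game R).

Lemma cesaro_le (y : nat -> R) (a e : R) : 0 < e ->
  (\forall k \near \oo, y k <= a) ->
  \forall n \near \oo, n%:R^-1 * \sum_(k < n) y k <= a + e.
Proof.
(* [b] is the total deviation before the bound sets in at [N]; once [n] exceeds [b / e] it adds at
   most [e] to the average. *)
move=> e0 [N _ HN]; set b := \sum_(0 <= k < N) `|y k - a|.
have b0 : 0 <= b by apply: sumr_ge0.
exists (maxn N (Num.truncn (b / e)).+1) => // n /=; rewrite geq_max => /andP[Nn bn].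
have n0 : (0 : R) < n%:R by rewrite ltr0n; apply: leq_trans bn.
have be : b <= e * n%:R.
  rewrite mulrC -ler_pdivrMr //; apply/ltW/(lt_le_trans (truncnS_gt _)).
  by rewrite ler_nat.
rewrite mulrC ler_pdivrMr //.
have -> : \sum_(k < n) y k = a * n%:R + \sum_(k < n) (y k - a).
  by rewrite sumrB sumr_const card_ord -mulr_natr; lra.
rewrite mulrDl lerD2l; apply: le_trans be.
rewrite -(big_mkord xpredT (fun k => y k - a)) (big_cat_nat (n := N)) //=.
rewrite -[leRHS]addr0; apply: lerD; first by apply: ler_sum => k _; exact: ler_norm.
rewrite big_nat_cond; apply: sumr_le0 => k /andP[/andP[Nk _] _].
by rewrite subr_le0; apply: HN.
Qed.

(** Averaging against empirical frequencies is averaging over time, which turns regret bounds into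
    statements on mixed actions. *)
Lemma count_average (I : finType) (S : Type) (b : nat -> I) (r : nat -> S)
    (w : I -> R) n :
  \sum_i (count (fun e => e.1 == i) [seq (b k, r k) | k <- iota 0 n])%:R / n%:R * w i =
  n%:R^-1 * \sum_(k < n) w (b k).
Proof.
have cE i : (count (fun e => e.1 == i) [seq (b k, r k) | k <- iota 0 n])%:R =
    \sum_(k < n) (b k == i)%:R :> R.
  rewrite count_map -(big_mkord xpredT (fun k => (b k == i)%:R)) -sum1_count.
  by rewrite natr_sum big_mkcond /index_iota subn0; apply: eq_bigr => k _ /=; case: eqP.
under eq_bigr do rewrite cE mulr_suml mulr_suml.
rewrite exchange_big mulr_sumr; apply: eq_bigr => k _.
rewrite (bigD1 (b k)) //= eqxx mul1r big1 ?addr0 // => i /negPf nk.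
by rewrite eq_sym nk !mul0r.
Qed.

Variables (c : nat -> choices G) (eps : R).
Hypothesis eps_ge0 : 0 <= eps.
Implicit Types (h g : inner G).
Hypothesis io : forall h, visited_io c h.
Hypothesis regret1 : forall h (e : R), 0 < e -> \forall n \near \oo, forall i,
  n%:R^-1 * \sum_(k < n) visit_payoff c k i (visit_choice c h k).2 <=
  n%:R^-1 * \sum_(k < n) visit_reward c h k + eps + e.
Hypothesis regret2 : forall h (e : R), 0 < e -> \forall n \near \oo, forall j,
  n%:R^-1 * \sum_(k < n) visit_reward c h k - eps - e <=
  n%:R^-1 * \sum_(k < n) visit_payoff c k (visit_choice c h k).1 j.

Definition mean_reward t h : R :=
  reward_sum (state_after c t h) / (nvisits c t h)%:R.

Definition freq1 t h (i : 'I_(nact1 h)) : R :=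
  (count (fun e => e.1 == i) (hist1 (state_after c t h)))%:R / (nvisits c t h)%:R.

Definition freq2 t h (j : 'I_(nact2 h)) : R :=
  (count (fun e => e.1 == j) (hist2 (state_after c t h)))%:R / (nvisits c t h)%:R.

Lemma nvisits_cvg h : nvisits c ^~ h @ \oo --> \oo.
Proof.
apply/cvgnyPge => A; have [t At] := io h A.
exists t.+1 => // s /= ts; apply: leq_trans (nvisits_mono c h ts); exact: ltnW.
Qed.

Lemma near_nvisits h (Q : set nat) :
  nbhs \oo Q -> \forall t \near \oo, Q (nvisits c t h).
Proof. exact: (nvisits_cvg h). Qed.

Lemma leq_visit_time h k : (k <= visit_time c h k)%N.
Proof.
elim: k => [//|k IHk]; exact: leq_ltn_trans IHk (visit_time_ltS k (io h)).
Qed.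

Lemma near_visit_time h (Q : set nat) :
  nbhs \oo Q -> \forall k \near \oo, Q (visit_time c h k).
Proof.
move=> [N _ HN]; exists N => // k /= Nk; apply: HN => /=.
exact: leq_trans Nk (leq_visit_time h k).
Qed.

Lemma nvisits_gt0 h : \forall t \near \oo, (0 < nvisits c t h)%N.
Proof. exact: (@near_nvisits h (fun n => (0 < n)%N) (nbhs_infty_ge 1)). Qed.

Lemma sum_freq1 t h (w : 'I_(nact1 h) -> R) (n := nvisits c t h) :
  \sum_i freq1 t i * w i = n%:R^-1 * \sum_(k < n) w (visit_choice c h k).1.
Proof.
rewrite /freq1; have [-> _ _] := node_history c t h.
exact: (count_average (fun k => (visit_choice c h k).1)).
Qed.

Lemma sum_freq2 t h (w : 'I_(nact2 h) -> R) (n := nvisits c t h) :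
  \sum_j freq2 t j * w j = n%:R^-1 * \sum_(k < n) w (visit_choice c h k).2.
Proof.
rewrite /freq2; have [_ -> _] := node_history c t h.
exact: (count_average (fun k => (visit_choice c h k).2)).
Qed.

Lemma freq1_distr t h : (0 < nvisits c t h)%N -> is_distr (@freq1 t h).
Proof.
move=> n0; split=> [i|]; first by rewrite /freq1 divr_ge0.
under eq_bigr do rewrite -[freq1 _ _]mulr1; rewrite sum_freq1 sumr_const card_ord.
by rewrite mulVf // pnatr_eq0 -lt0n.
Qed.

Lemma freq2_distr t h : (0 < nvisits c t h)%N -> is_distr (@freq2 t h).
Proof.
move=> n0; split=> [i|]; first by rewrite /freq2 divr_ge0.
under eq_bigr do rewrite -[freq2 _ _]mulr1; rewrite sum_freq2 sumr_const card_ord.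
by rewrite mulVf // pnatr_eq0 -lt0n.
Qed.

Lemma mean_rewardE t h (n := nvisits c t h) :
  mean_reward t h = n%:R^-1 * \sum_(k < n) visit_reward c h k.
Proof. by rewrite /mean_reward; have [_ _ ->] := node_history c t h; rewrite mulrC. Qed.

(** The hypotheses [mean_ge] and [mean_le] of the equilibrium argument, with [e] in place of
    [eta]. *)
Definition empirical_bounds e t h : Prop :=
  (forall i, \sum_j freq2 t j * value (@succ R G h i j) <=
     mean_reward t h + ((codepth (inl h))%:R * eps + e)) /\
  (forall j, mean_reward t h - ((codepth (inl h))%:R * eps + e) <=
     \sum_i freq1 t i * value (@succ R G h i j)).

(** Cesaro averaging replaces payoffs by values along the actions actually played; the regret bound
    then adds one [eps]. *)
Lemma near_empirical_bounds h :
  (forall i j (e : R), 0 < e -> \forall k \near \oo,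
     `|visit_payoff c k i j - value (@succ R G h i j)| <=
       (codepth (inl h)).-1%:R * eps + e) ->
  forall e : R, 0 < e -> \forall t \near \oo, empirical_bounds e t h.
Proof.
move=> pay e e0; pose d := (codepth (inl h)).-1.
(* One third each for the payoffs, the Cesaro averages and the regrets. *)
have e3 : 0 < e / 3 by rewrite divr_gt0.
have dE : (codepth (inl h))%:R = d%:R + 1 :> R.
  by rewrite natr1 /d prednK // codepth_gt0.
have payE : \forall k \near \oo, forall i j,
    `|visit_payoff c k i j - value (@succ R G h i j)| <= d%:R * eps + e / 3.
  apply: filter_forall => i.
  by apply: filter_forall => j; exact: pay.
have b1 : \forall n \near \oo, forall i,
    n%:R^-1 * \sum_(k < n) (value (succ i (visit_choice c h k).2) -
      visit_payoff c k i (visit_choice c h k).2) <= d%:R * eps + e / 3 + e / 3.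
  apply: filter_forall => i.
  apply: (@cesaro_le (fun k => value (succ i (visit_choice c h k).2) -
    visit_payoff c k i (visit_choice c h k).2)) => //.
  apply: filterS payE => k /(_ i (visit_choice c h k).2).
  by rewrite ler_norml => /andP[]; lra.
have b2 : \forall n \near \oo, forall j,
    n%:R^-1 * \sum_(k < n) (visit_payoff c k (visit_choice c h k).1 j -
      value (succ (visit_choice c h k).1 j)) <= d%:R * eps + e / 3 + e / 3.
  apply: filter_forall => j.
  apply: (@cesaro_le (fun k => visit_payoff c k (visit_choice c h k).1 j -
    value (succ (visit_choice c h k).1 j))) => //.
  apply: filterS payE => k /(_ (visit_choice c h k).1 j).
  by rewrite ler_norml => /andP[].
apply: filterS (near_nvisits h (filterI (filterI b1 (regret1 h e3))
  (filterI b2 (regret2 h e3)))) => t /= [[B1 R1] [B2 R2]]; rewrite /empirical_bounds dE; split=> [i|j].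
  rewrite sum_freq2 mean_rewardE.
  by have := B1 i; have := R1 i; rewrite sumrB mulrBr; lra.
rewrite sum_freq1 mean_rewardE.
by have := B2 j; have := R2 j; rewrite sumrB mulrBr; lra.
Qed.

Lemma near_mean_reward h :
  (forall e : R, 0 < e -> \forall t \near \oo, empirical_bounds e t h) ->
  forall e : R, 0 < e -> \forall t \near \oo,
    `|mean_reward t h - value (inl h)| <= (codepth (inl h))%:R * eps + e.
Proof.
move=> B e e0; apply: filterS (filterI (B e e0) (nvisits_gt0 h)) => t [[B1 B2] n0].
have [/(_ _ (freq2_distr n0))[i lei] /(_ _ (freq1_distr n0))[j lej]] := value_is_value h.
by rewrite ler_norml; have := B1 i; have := B2 j; lra.
Qed.

(** One more reward in [[0, 1]] moves a mean of [n] rewards by at most [1 / (n + 1)]. So what a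
    state would return stays close to its mean reward, even in simulations that do not reach it. *)
Lemma simulate_mean k c0 t h : (0 < nvisits c t h)%N ->
  `|(simulate k.+1 c0 (state_after c t) (inl h)).1 - mean_reward t h| <=
    (nvisits c t h).+1%:R^-1.
Proof.
move=> n0; rewrite simulateE /=; set x := (simulate _ _ _ _).1.
have /andP[x0 x1] : 0 <= x <= 1.
  by have [] := simulate_bounded k c0 (succ (c0 h).1 (c0 h).2) (state_after_bounded c t).
have /andP[r0 r1] := state_after_bounded c t h.
rewrite /mean_reward -/(nvisits c t h) in r1 *.
set n := nvisits c t h in n0 r1 *; set X := reward_sum _ in r0 r1 *.
have n0' : (0 : R) < n%:R by rewrite ltr0n.
have nS : (0 : R) < n.+1%:R by rewrite ltr0n.
have -> : (X + x) / n.+1%:R - X / n%:R = (x - X / n%:R) / n.+1%:R.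
  by rewrite -natr1; field; rewrite natr1 !gt_eqF.
rewrite normrM (gtr0_norm (x := _^-1)) ?invr_gt0 // -[leRHS]mul1r.
rewrite ler_wpM2r ?invr_ge0 ?(ltW nS) //.
have : 0 <= X / n%:R <= 1 by rewrite divr_ge0 ?(ltW n0') // ler_pdivrMr // mul1r.
by rewrite ler_norml => /andP[]; lra.
Qed.

(** Induction on a bound for the codepth: a payoff at [h] is either a terminal utility or
    asymptotically the mean reward of a successor [g], covered by the induction hypothesis. *)
Lemma near_mean_empirical d h : (codepth (inl h) <= d)%N -> forall e : R, 0 < e ->
  \forall t \near \oo, empirical_bounds e t h.
Proof.
elim: d h => [|d IHd] h le; first by have := codepth_gt0 h; lia.
apply: near_empirical_bounds => i j e e0; have lts := codepth_succ i j.
have lej : (codepth (succ i j))%:R * eps <= (codepth (inl h)).-1%:R * eps.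
  by rewrite ler_wpM2r // ler_nat; lia.
case es : (succ i j) lts lej => [g|z] lts lej; last first.
  near=> k; rewrite /visit_payoff /payoff es simulate_terminal /= subrr normr0.
  by rewrite addr_ge0 ?mulr_ge0 ?(ltW e0).
have e2 : 0 < e / 2 by rewrite divr_gt0.
have led : (codepth (inl g) <= d)%N by lia.
have mg := near_mean_reward (IHd g led) e2.
have ng : \forall t \near \oo, ((nvisits c t g).+1%:R^-1 : R) <= e / 2.
  apply: (@near_nvisits g (fun n => (n.+1%:R^-1 : R) <= e / 2)).
  near=> n; rewrite -[leRHS]invrK lef_pV2 ?posrE ?invr_gt0 ?ltr0n //.
  apply/ltW/(lt_le_trans (truncnS_gt _)); rewrite ler_nat ltnS.
  near: n; exact: nbhs_infty_ge.
(* Estimates at [g] valid for large times are evaluated at the visit times of [h], and so become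
   estimates for large visit numbers [k]. *)
apply: filterS (near_visit_time h (filterI (filterI mg ng) (nvisits_gt0 g))) => k [[mk nk] n0]; rewrite /visit_payoff /payoff es.
rewrite -(fuel_succ es) fuelS.
have sk := simulate_mean (fuel g).-1 (c (visit_time c h k)) n0.
apply: le_trans (ler_distD (mean_reward (visit_time c h k) g) _ _) _.
rewrite [X in _ <= _ + X](splitr e) addrCA; apply: lerD (le_trans sk nk) _.
by apply: le_trans mk _; rewrite lerD2r.
Unshelve. all: by end_near.
Qed.

Lemma near_subgame_perfect delta : 0 < eps -> 0 < delta ->
  \forall t \near \oo, forall s1 s2,
    empirical1 (state_after c t) s1 -> empirical2 (state_after c t) s2 ->
    subgame_perfect_eps_nash ((2 * (depth G)%:R ^+ 2 + delta) * eps) s1 s2.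
Proof.
move=> eps_gt0 delta0; set D : R := (depth G)%:R.
have D0 : 0 < D by rewrite ltr0n depth_gt0.
(* Chosen so that [4 * D * e = delta * eps]. *)
pose e := delta * eps / (4 * D).
have e0 : 0 < e by rewrite divr_gt0 ?mulr_gt0.
have B : \forall t \near \oo, forall h, empirical_bounds e t h /\ (0 < nvisits c t h)%N.
  apply: filter_forall => h; apply: filterI; last exact: nvisits_gt0.
  exact: near_mean_empirical (leqnn _) _ e0.
apply: filterS B => t B s1 s2 [d1 E1] [d2 E2].
have -> : (2 * D ^+ 2 + delta) * eps = 2 * D ^+ 2 * eps + 4 * D * e.
  by rewrite /e; field; rewrite gt_eqF.
have F1 h : s1 h = @freq1 t h by apply/funext => i; apply: E1; case: (B h).
have F2 h : s2 h = @freq2 t h by apply/funext => i; apply: E2; case: (B h).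
apply: (@subgame_perfect_of_mean _ _ s1 s2 d1 d2 eps e (mean_reward t)) => //.
- exact: ltW.
- by move=> h i; rewrite F2; have [[]] := B h.
- by move=> h j; rewrite F1; have [[]] := B h.
Qed.

End Asymptotics.

(** * Observations with countably many values *)

Section CountablePartition.
Context (d : measure_display) (T : measurableType d) (R : realType).

(** Unions of fibres of [phi]; with countably many measurable fibres, this is the sigma-algebra
    generated by [phi]. *)
Definition saturated (K : Type) (phi : T -> K) : set (set T) :=
  [set B | forall w w', phi w = phi w' -> B w -> B w'].

Lemma saturated_sigma_algebra (K : Type) (phi : T -> K) :
  sigma_algebra setT (saturated phi).
Proof.
split=> [w w' _ //|A sA w w' e [_ nA]|A sA w w' e [n _ An]].
  by split=> // /(sA _ _ (esym e)).
by exists n => //; apply: sA e An.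
Qed.

Lemma saturated_measurable (K : countType) (phi : T -> K) :
  (forall k, measurable (phi @^-1` [set k])) -> saturated phi `<=` measurable.
Proof.
move=> mphi B sB.
pose U k := if pselect (exists2 w, B w & phi w = k) then phi @^-1` [set k] else set0.
have -> : B = \bigcup_k U k.
  apply/seteqP; split=> [w Bw|w [k _]].
    by exists (phi w) => //; rewrite /U; case: pselect => // - []; exists w.
  by rewrite /U; case: pselect => // -[w' Bw' e'] /= e; apply: sB Bw'; rewrite e' e.
apply: countable_bigcupT_measurable => [|k]; first exact: countableP.
by rewrite /U; case: pselect => ? /=; [exact: mphi|exact: measurable0].
Qed.

Lemma probability_fin_partition (P : probability T R) (I : finType) (f : T -> I)
    (A : set T) :
  measurable A -> (forall i, measurable [set w | f w = i]) ->
  P A = \sum_i P (A `&` [set w | f w = i]).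
Proof.
move=> mA mf; pose F i := A `&` [set w | f w = i].
have {1}-> : A = \bigcup_(i in [set` index_enum I]) F i.
  apply/seteqP; split=> [w Aw|w [i _ []//]].
  by exists (f w) => //=; rewrite mem_index_enum.
rewrite measure_fin_bigcup.
- by rewrite -fsbig_seq // index_enum_uniq.
- exact: finite_seq.
- by move=> i j _ _ [w [[_ <-] [_ <-]]].
- by move=> i _; apply: measurableI.
Qed.

Lemma measureI_ae (P : probability T R) (A B : set T) :
  measurable A -> measurable B -> {ae P, forall w, A w} -> P (A `&` B) = P B.
Proof.
move=> mA mB; rewrite /almost_everywhere /= => aeA.
have nA : P (~` A) = 0%E by apply/negligibleP => //; exact: measurableC.
rewrite (measureDI P mB mA) setIC.
rewrite [X in (X + _)%E](_ : _ = 0%E) ?add0e //.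
apply: subset_measure0 nA; [exact: measurableD|exact: measurableC|].
by move=> w [].
Qed.

(** Events of [saturated phi] are countable unions of fibres on which [g] is constant, so countable
    additivity reduces the integral identity to one product formula per fibre. *)
Lemma cond_prob_saturated (P : probability T R) (K : countType) (phi : T -> K)
    (E : set T) (g : T -> R) :
  (forall k, measurable (phi @^-1` [set k])) -> measurable E ->
  (forall w, 0 <= g w) -> (forall w w', phi w = phi w' -> g w = g w') ->
  (forall w, P (phi @^-1` [set phi w] `&` E) =
             ((g w)%:E * P (phi @^-1` [set phi w]))%E) ->
  cond_prob P (saturated phi) E g.
Proof.
move=> mphi mE g0 gphi PE; have mS := saturated_measurable mphi.
split=> [Y mY w w' /gphi /= -> //|B sB].
have mB := mS _ sB.
pose D n := B `&` [set w | pickle (phi w) = n].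
have mD n : measurable (D n).
  by apply: mS => w w' e [Bw /= <-]; split; [exact: sB e Bw|rewrite /= e].
have tD : trivIset setT D by move=> m n _ _ [w [[_ <-] [_ <-]]].
have BD : B = \bigcup_n D n.
  apply/seteqP; split=> [w Bw|w [n _ []//]].
  by exists (pickle (phi w)).
have mg : measurable_fun B (EFin \o g).
  move=> _ Y mY; apply: mS => w w' e [Bw Yw]; split; first exact: sB e Bw.
  by rewrite /= -(gphi _ _ e).
transitivity (\sum_(0 <= n <oo) P (D n `&` E))%E.
  rewrite {1}BD setI_bigcupl measure_semi_bigcup //.
  - by move=> n; apply: measurableI.
  - by move=> m n _ _ [w [[[_ <-] _] [[_ <-] _]]].
  - by rewrite -setI_bigcupl -BD; apply: measurableI.
rewrite [in RHS]BD ge0_integral_bigcup //; last first.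
- by move=> w _; rewrite lee_fin.
- by rewrite -BD.
apply: eq_eseriesr => n _.
have [[w [Bw wn]]|D0] := pselect (exists w, D n w); last first.
  have -> : D n = set0.
    by apply/seteqP; split=> // w Dw; case: D0; exists w.
  by rewrite set0I measure0 integral_set0.
have -> : D n = phi @^-1` [set phi w].
  apply/seteqP; split=> [w' [Bw' wn']|w' /= e].
    by apply: (pcan_inj (@pickleK K)); rewrite wn' wn.
  by split; [apply: sB Bw|rewrite /= e].
rewrite PE -integral_cst //; apply: eq_integral => w'.
by rewrite inE => /= e; rewrite (gphi w' w).
Qed.

Lemma limn_esup_near (u : nat -> R) (a e : R) : 0 < e ->
  (limn_esup (fun t => (u t)%:E) <= a%:E)%E -> \forall n \near \oo, u n <= a + e.
Proof.
move=> e0; rewrite limn_esup_lim.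
have /cvg_lim -> // := ereal_nonincreasing_cvgn (nonincreasing_esups (fun t => (u t)%:E)).
move=> le; have : (ereal_inf (range (esups (fun t => (u t)%:E))) < (a + e)%:E)%E.
  by apply: le_lt_trans le _; rewrite lte_fin ltrDl.
move=> /ereal_inf_lt[_ [N _ <-]] lt; exists N => // n /= Nn.
rewrite -lee_fin; apply: le_trans (ltW lt); apply: ereal_sup_ubound.
by exists n.
Qed.

End CountablePartition.

(** * The repeated game at a state *)

Section SameAt.
Variables (R : realType) (G : game R).
Implicit Types (h : inner G) (c : nat -> choices G).

(** Agreement on all that precedes the draw at [h] in simulation [s], the draws elsewhere in that
    simulation included. It fixes the visit time and the payoffs but not the action. *)
Definition same_at h s c c' : Prop :=
  (forall r, (r < s)%N -> c r = c' r) /\ (forall g, g != h -> c s g = c' s g).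

Lemma nvisits_same_at h s c c' : same_at h s c c' ->
  nvisits c s h = nvisits c' s h /\ nvisits c s.+1 h = nvisits c' s.+1 h.
Proof.
move=> [cc' off]; rewrite /nvisits (state_after_eq cc'); split=> //.
by rewrite /= (state_after_eq cc'); apply: visits_off.
Qed.

Lemma visit_time_same_at h k c c' : visited_io c h ->
  same_at h (visit_time c h k) c c' -> visit_time c' h k = visit_time c h k.
Proof.
move=> io /nvisits_same_at[e eS]; have [Vt VSt] := visit_timeP k io.
by apply: visit_time_uniq; rewrite -?e -?eS.
Qed.

Lemma visit_payoff_same_at h k c c' (i : 'I_(nact1 h)) (j : 'I_(nact2 h)) :
  visited_io c h -> same_at h (visit_time c h k) c c' ->
  visit_payoff c' k i j = visit_payoff c k i j.
Proof.
move=> io same; rewrite /visit_payoff (visit_time_same_at io same).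
have [cc' off] := same; rewrite (state_after_eq cc').
by apply: payoff_off => g /off.
Qed.

Lemma visit_time_lt h c r k : visited_io c h -> (r < k)%N ->
  (visit_time c h r < visit_time c h k)%N.
Proof.
move=> io; elim: k => [//|k IHk]; rewrite ltnS leq_eqVlt => /predU1P[->|/IHk lt].
  exact: visit_time_ltS.
exact: ltn_trans lt (visit_time_ltS k io).
Qed.

Lemma same_at_before h c c' r k : visited_io c h -> (r < k)%N ->
  (forall s, (s < visit_time c h k)%N -> c s = c' s) ->
  same_at h (visit_time c h r) c c' /\ visit_choice c' h r = visit_choice c h r.
Proof.
move=> io rk cc'; have lt := visit_time_lt io rk.
have same : same_at h (visit_time c h r) c c'.
  by split=> [s slt|g _]; rewrite cc' // (ltn_trans slt).
by rewrite /visit_choice (visit_time_same_at io same) cc'.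
Qed.

(** The finite-function copy of [choices] is a [countType], which lets observations take values in
    one. *)
Definition code (g : choices G) :
    {dffun forall h : inner G, ('I_(nact1 h) * 'I_(nact2 h))%type} :=
  [ffun h => g h].

Lemma code_inj : injective code.
Proof.
move=> g g' /ffunP e; apply: functional_extensionality_dep => h.
by have := e h; rewrite !ffunE.
Qed.

End SameAt.

(** * Conditional law of the actions at a state *)

Section Run.
Variables (R : realType) (G : game R) (A : algorithm R).
Variables (d : measure_display) (T : measurableType d) (P : probability T R).
Variables (F : nat -> set (set T)) (c : nat -> T -> choices G).
Hypothesis run : search_run A P F c.
Implicit Types (g : choices G) (gam : nat -> choices G).

Lemma choices_eventE s g :
  [set w | forall h, c s w h = g h] = [set w | c s w = g].
Proof.
apply/seteqP; split=> w /= => [e|-> //].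
exact: functional_extensionality_dep.
Qed.

Lemma sigma_algebra_setI (S : set (set T)) (B C : set T) :
  sigma_algebra setT S -> S B -> S C -> S (B `&` C).
Proof.
move=> [_ SC SU] SB SC'.
pose D n := if n is 0%N then setT `\` B else setT `\` C.
suff -> : B `&` C = setT `\` \bigcup_n D n by apply/SC/SU => -[|n]; apply: SC.
apply/seteqP; split=> [w [Bw Cw]|w [_ nD]].
  by split=> // -[[|n] _ []].
by split; apply: contrapT => n; apply: nD; [exists 0%N|exists 1%N].
Qed.

Definition past gam s : set T := [set w | forall r, (r < s)%N -> c r w = gam r].

Lemma pastS gam s : past gam s.+1 = past gam s `&` [set w | c s w = gam s].
Proof.
apply/seteqP; split=> [w e|w [e es] r]; first by split=> [r lt|]; apply: e => //; exact: ltnW.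
by rewrite ltnS leq_eqVlt => /predU1P[->|/e].
Qed.

Lemma past_filtration gam s : F s (past gam s).
Proof.
have [[sF _ mF] cF _] := run; elim: s => [|s IHs].
  have [F0 /(_ _ F0)] := sF 0%N; rewrite setD0 => + _; congr (F _).
  by apply/seteqP; split=> // w _ r.
rewrite pastS; apply: sigma_algebra_setI (sF _) _ _; first exact: mF (leqnSn s) _ IHs.
by rewrite -choices_eventE; exact: cF.
Qed.

Lemma past_measurable gam s : measurable (past gam s).
Proof. have [[_ mF _] _ _] := run; exact/(mF s)/past_filtration. Qed.

(** The selections before time [s] form a word over a finite alphabet, hence take countably many
    values, each on an event [past]. *)
Lemma measurable_past s (Q : (nat -> choices G) -> Prop) :
  (forall gam gam', (forall r, (r < s)%N -> gam r = gam' r) -> Q gam -> Q gam') ->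
  measurable [set w | Q (c ^~ w)].
Proof.
move=> Qs; pose phi w := [seq code (c r w) | r <- iota 0 s].
have phiE w w' : phi w = phi w' -> forall r, (r < s)%N -> c r w = c r w'.
  move=> /eq_in_map e r lt; apply/code_inj/e.
  by rewrite mem_iota.
apply: (@saturated_measurable _ _ _ phi) => [k|w w' /phiE e]; last exact: Qs.
have [[w0 /= e0]|n0] := pselect (exists w, phi w = k); last first.
  rewrite (_ : _ @^-1` _ = set0); first exact: measurable0.
  by apply/seteqP; split=> // w e; case: n0; exists w.
rewrite (_ : _ @^-1` _ = past (c ^~ w0) s); first exact: past_measurable.
apply/seteqP; split=> [w /= e|w /= e]; first by apply: phiE; rewrite e0.
by rewrite -e0; apply/eq_in_map => r; rewrite mem_iota add0n => /andP[_ /e ->].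
Qed.

Definition draw_law gam s g : R := \prod_(h : inner G)
  (A _ (hist1 (state_after gam s h)) (g h).1 *
   A _ (hist2 (state_after gam s h)) (g h).2).

(** On [past gam s] all recorded histories are constant, so the conditional law integrates to a
    plain product. *)
Lemma draw_prob gam s g : P (past gam s `&` [set w | c s w = g]) =
  ((draw_law gam s g)%:E * P (past gam s))%E.
Proof.
have [_ _ /(_ s g)[_ cp]] := run.
rewrite -choices_eventE cp; last exact: past_filtration.
rewrite -integral_cst; last exact: past_measurable.
apply: eq_integral => w; rewrite inE => e /=.
by rewrite (@state_after_eq _ _ (c ^~ w) gam).
Qed.

Section Node.
Variable h : inner G.
Let action := ('I_(nact1 h) * 'I_(nact2 h))%type.

Definition recurrent w : Prop := visited_io (c ^~ w) h.
Hypothesis recurrent_ae : {ae P, forall w, recurrent w}.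

Lemma recurrent_measurable : measurable [set w | recurrent w].
Proof.
rewrite (_ : mkset _ = \bigcap_k \bigcup_t [set w | (k < nvisits (c ^~ w) t.+1 h)%N]).
  apply: bigcapT_measurable => k; apply: bigcupT_measurable => t.
  apply: (@measurable_past t.+1 (fun gam => (k < nvisits gam t.+1 h)%N)) => gam gam' e.
  by rewrite /nvisits (state_after_eq e).
apply/seteqP; split=> [w io k _|w io k]; first by have [t] := io k; exists t.
by have [t _] := io k I; exists t.
Qed.

Let tau w k := visit_time (c ^~ w) h k.

Definition mask (nu : action -> action) g : choices G := dfwith g h (nu (g h)).

Lemma mask_off nu g g' : mask nu g = mask nu g' -> forall x, x != h -> g x = g' x.
Proof.
move=> e x xh; have := f_equal (fun g => g x) e.
by rewrite /mask !dfwithout 1?eq_sym.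
Qed.

Lemma mask_at nu g g' : mask nu g = mask nu g' -> nu (g h) = nu (g' h).
Proof. by move=> e; have := f_equal (fun g => g h) e; rewrite /mask !dfwithin. Qed.

(* What is known before the action of the visit number [k] at [h] is completed:
   the past of the search, the selections made elsewhere during the current
   simulation, and the part of the joint action at [h] retained by [nu]. *)
Definition observation (nu : action -> action) k w :=
  if `[< recurrent w >] then
    Some ([seq code (c r w) | r <- iota 0 (tau w k)], code (mask nu (c (tau w k) w)))
  else None.

Lemma observation_eq nu k w w' : recurrent w -> observation nu k w = observation nu k w' ->
  [/\ recurrent w', tau w' k = tau w k, forall r, (r < tau w k)%N -> c r w = c r w' &
      mask nu (c (tau w k) w) = mask nu (c (tau w k) w')].
Proof.
move=> gw; rewrite /observation asboolT //; case: asboolP => // gw' [e m].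
have et : tau w' k = tau w k by have := f_equal size e; rewrite !size_map !size_iota.
rewrite et in e m; split=> //; last exact: code_inj m.
move: e => /eq_in_map e r lt; apply/code_inj/e.
by rewrite mem_iota.
Qed.

Lemma observation_same_at nu k w w' : recurrent w -> observation nu k w = observation nu k w' ->
  same_at h (tau w k) (c ^~ w) (c ^~ w').
Proof. by move=> gw /(observation_eq gw)[_ _ e m]; split=> // x xh; apply: mask_off m x xh. Qed.

Lemma observation_intro nu k w w' : recurrent w -> recurrent w' ->
  (forall r, (r < tau w k)%N -> c r w = c r w') ->
  mask nu (c (tau w k) w) = mask nu (c (tau w k) w') ->
  observation nu k w = observation nu k w'.
Proof.
move=> gw gw' e m; have same : same_at h (tau w k) (c ^~ w) (c ^~ w').
  by split=> // x xh; apply: mask_off m x xh.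
have et : tau w' k = tau w k := visit_time_same_at gw same.
rewrite /observation !asboolT // et m; congr (Some (_, _)); apply/eq_in_map => r.
by rewrite mem_iota add0n => /andP[_ /e ->].
Qed.

Lemma observation_bad nu k w w' : ~ recurrent w -> observation nu k w = observation nu k w' ->
  ~ recurrent w'.
Proof.
by move=> bw; rewrite /observation asboolF //; case: asboolP.
Qed.

(** The random visit time is constant on such a fibre, which is thereby described at a deterministic
    time, where [draw_prob] applies. *)
Lemma observation_fibre nu k w0 : recurrent w0 ->
  observation nu k @^-1` [set observation nu k w0] =
  [set w | recurrent w] `&` (past (c ^~ w0) (tau w0 k) `&`
    [set w | mask nu (c (tau w0 k) w) = mask nu (c (tau w0 k) w0)]).
Proof.
move=> gw0; apply/seteqP; split=> w /=.
  move=> /esym/(observation_eq gw0)[gw _ e m]; split=> //; split=> // r lt.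
  by rewrite e.
by move=> [gw [e m]]; apply/esym/observation_intro => // r /e.
Qed.

Lemma mask_measurable nu s g : measurable [set w | mask nu (c s w) = mask nu g].
Proof.
apply: (@measurable_past s.+1 (fun gam => mask nu (gam s) = mask nu g)) => gam gam' e.
by rewrite e.
Qed.

Lemma observation_measurable nu k o : measurable (observation nu k @^-1` [set o]).
Proof.
have [[w0 gw0 /= <-]|no] := pselect (exists2 w, recurrent w & observation nu k w = o).
  rewrite observation_fibre //; apply: measurableI; first exact: recurrent_measurable.
  by apply: measurableI; [exact: past_measurable|exact: mask_measurable].
case: o no => [x |] no.
  rewrite (_ : _ @^-1` _ = set0); first exact: measurable0.
  apply/seteqP; split=> // w /= e; case: no; exists w => //.
  by move: e; rewrite /observation; case: asboolP.
rewrite (_ : _ @^-1` _ = ~` [set w | recurrent w]); first exact/measurableC/recurrent_measurable.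
by apply/seteqP; split=> w; rewrite /= /observation; case: asboolP.
Qed.

(** The simulation of an earlier visit, its action at [h] included, lies in the recorded past of any
    later visit. *)
Lemma observation_mono nu k l w w' : (k <= l)%N ->
  observation nu l w = observation nu l w' -> observation nu k w = observation nu k w'.
Proof.
move=> /subnK <-; elim: (l - k)%N => [//|n IHn]; rewrite addSn => e; apply: IHn.
set m := (n + k)%N in e *; have [gw|bw] := pselect (recurrent w).
  have [gw' _ cc' _] := observation_eq gw e.
  have lt : (tau w m < tau w m.+1)%N := visit_time_ltS m gw.
  apply: observation_intro => // [r rm|]; last by rewrite cc'.
  by rewrite cc' // (ltn_trans rm).
have bw' := observation_bad bw e.
by rewrite /observation !asboolF.
Qed.

Definition node_filtration nu k := saturated (observation nu k).

Lemma node_filtrationP nu : filtration (node_filtration nu).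
Proof.
split=> [k|k|k l kl B sB w w' e]; first exact: saturated_sigma_algebra.
  exact/saturated_measurable/observation_measurable.
by apply: sB; apply: observation_mono e.
Qed.

(** The default keeps the action constant on the fibre [None] of [observation], as measurability for
    [node_filtration] requires. *)
Definition node_action k w : action :=
  if `[< recurrent w >] then visit_choice (c ^~ w) h k
  else (Ordinal (nact1_gt0 h), Ordinal (nact2_gt0 h)).

Definition node_payoff k w (i : 'I_(nact1 h)) (j : 'I_(nact2 h)) : R :=
  if `[< recurrent w >] then visit_payoff (c ^~ w) k i j else 0.

Lemma node_payoff_01 k w i j : 0 <= node_payoff k w i j <= 1.
Proof.
rewrite /node_payoff; case: ifP => _; last by rewrite lexx ler01.
exact: payoff_01.
Qed.

Lemma node_payoff_observation nu k w w' : observation nu k w = observation nu k w' ->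
  node_payoff k w = node_payoff k w'.
Proof.
move=> e; apply/funext => i; apply/funext => j; rewrite /node_payoff.
have [gw|bw] := pselect (recurrent w).
  have [gw' _ _ _] := observation_eq gw e; rewrite !asboolT //.
  exact/esym/(visit_payoff_same_at _ _ gw (observation_same_at gw e)).
by have bw' := observation_bad bw e; rewrite !asboolF.
Qed.

Lemma node_action_before nu r k w w' : (r < k)%N ->
  observation nu k w = observation nu k w' -> node_action r w = node_action r w'.
Proof.
move=> rk e; rewrite /node_action; have [gw|bw] := pselect (recurrent w).
  have [gw' _ cc' _] := observation_eq gw e; rewrite !asboolT //.
  by have [_ ->] := same_at_before gw rk cc'.
by have bw' := observation_bad bw e; rewrite !asboolF.
Qed.

Lemma node_action_retained nu k w w' :
  observation nu k w = observation nu k w' -> nu (node_action k w) = nu (node_action k w').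
Proof.
move=> e; rewrite /node_action; have [gw|bw] := pselect (recurrent w).
  have [gw' et _ m] := observation_eq gw e; rewrite !asboolT //.
  by rewrite /visit_choice -/(tau w k) -/(tau w' k) et (mask_at m).
by have bw' := observation_bad bw e; rewrite !asboolF.
Qed.

Lemma node_action_measurable (Q : action -> Prop) k :
  measurable [set w | Q (node_action k w)].
Proof.
apply: (@saturated_measurable _ _ _ (observation id k)) => [x |w w' e /=].
  exact: observation_measurable.
by have /= -> := node_action_retained e.
Qed.

Section HiddenPart.
(* [nu] erases a component [alpha] of the joint action, which [ups] resets. *)
Variables (I : finType) (nu : action -> action) (alpha : action -> I)
          (ups : action -> I -> action).
Hypothesis nu_ups : forall x i, nu (ups x i) = nu x.
Hypothesis alpha_ups : forall x i, alpha (ups x i) = i.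
Hypothesis ups_alpha : forall x x', nu x' = nu x -> x' = ups x (alpha x').

Lemma fibre_prob k w0 (p : I -> R) (rho : action -> R)
    (st := state_after (c ^~ w0) (tau w0 k) h) (i : I) : recurrent w0 ->
  (forall x i, A _ (hist1 st) (ups x i).1 * A _ (hist2 st) (ups x i).2 = p i * rho x) ->
  \sum_i p i = 1 ->
  P (observation nu k @^-1` [set observation nu k w0] `&`
       [set w | alpha (node_action k w) = i]) =
  ((p i)%:E * P (observation nu k @^-1` [set observation nu k w0]))%E.
Proof.
move=> gw0 prod_st p1; set s := tau w0 k in st prod_st *.
pose B := past (c ^~ w0) s; pose g i := dfwith (c s w0) h (ups (c s w0 h) i).
pose M := [set w | mask nu (c s w) = mask nu (c s w0)].
have mB : measurable B by exact: past_measurable.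
have mM : measurable M by exact: mask_measurable.
have mE j : measurable [set w | alpha (c s w h) = j].
  apply: (@measurable_past s.+1 (fun gam => alpha (gam s h) = j)) => gam gam' e.
  by rewrite e.
have ME j : M `&` [set w | alpha (c s w h) = j] = [set w | c s w = g j].
  apply/seteqP; split=> w /=.
    move=> [m <-]; apply: functional_extensionality_dep => x.
    have [->|xh] := eqVneq x h; first by rewrite /g dfwithin; apply/ups_alpha/(mask_at m).
    by rewrite /g dfwithout 1?eq_sym //; apply: mask_off m x xh.
  rewrite /M /= => ->; rewrite /g dfwithin; split=> //.
  apply: functional_extensionality_dep => x; rewrite /mask dfwithin nu_ups.
  by have [<-|xh] := eqVneq h x; rewrite ?dfwithin ?dfwithout.
pose K := (rho (c s w0 h) * \prod_(x | x != h)
  (A _ (hist1 (state_after (c ^~ w0) s x)) (c s w0 x).1 *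
   A _ (hist2 (state_after (c ^~ w0) s x)) (c s w0 x).2))%R.
have law j : draw_law (c ^~ w0) s (g j) = p j * K.
  rewrite /draw_law (bigD1 h) //= /g dfwithin -/st prod_st -mulrA; congr (_ * (_ * _)).
  by apply: eq_bigr => x xh; rewrite dfwithout 1?eq_sym.
have PE j : P (B `&` M `&` [set w | alpha (c s w h) = j]) = ((p j * K)%:E * P B)%E.
  by rewrite -setIA ME draw_prob law.
have PM : P (B `&` M) = (K%:E * P B)%E.
  rewrite (@probability_fin_partition _ _ _ P _ (fun w => alpha (c s w h))) //; last first.
    exact: measurableI.
  under eq_bigr do rewrite PE.
  rewrite -(fineK (fin_num_measure P _ mB)) //.
  under eq_bigr do rewrite -EFinM.
  by rewrite sumEFin -!mulr_suml p1 mul1r EFinM.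
rewrite observation_fibre // -/s -/B -/M.
(* On this fibre visit [k] takes place at time [s], whatever is drawn at [h]. *)
have -> : [set w | recurrent w] `&` (B `&` M) `&` [set w | alpha (node_action k w) = i] =
    [set w | recurrent w] `&` (B `&` M `&` [set w | alpha (c s w h) = i]).
  rewrite -!setIA; apply/seteqP; split=> w [gw [Bw [Mw e]]]; do ?split=> //; move: e => /=.
    rewrite /node_action asboolT //.
    rewrite /visit_choice -/(tau w k); suff -> : tau w k = s by [].
    apply: visit_time_same_at => //; split=> [r /Bw //|x xh].
    by apply: mask_off (esym Mw) x xh.
  rewrite /node_action asboolT //.
  rewrite /visit_choice -/(tau w k); suff -> : tau w k = s by [].
  apply: visit_time_same_at => //; split=> [r /Bw //|x xh].
  by apply: mask_off (esym Mw) x xh.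
have mG := recurrent_measurable.
have mBM : measurable (B `&` M) by apply: measurableI.
rewrite (measureI_ae mG mBM recurrent_ae) (measureI_ae mG _ recurrent_ae); last exact: measurableI.
by rewrite PE PM EFinM muleA.
Qed.

Lemma node_cond_prob k (p : T -> I -> R) (i : I) :
  (forall w, is_distr (p w)) ->
  (forall w w', observation nu k w = observation nu k w' -> p w = p w') ->
  (forall w (st := state_after (c ^~ w) (tau w k) h), recurrent w ->
    exists rho : action -> R, forall x i,
      A _ (hist1 st) (ups x i).1 * A _ (hist2 st) (ups x i).2 = p w i * rho x) ->
  cond_prob P (node_filtration nu k) [set w | alpha (node_action k w) = i] (p ^~ i).
Proof.
move=> dp po prod_p; apply: cond_prob_saturated.
- exact: observation_measurable.
- exact: node_action_measurable (fun x => alpha x = i) k.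
- by move=> w; have [] := dp w.
- by move=> w w' /po ->.
move=> w; have [gw|bw] := pselect (recurrent w).
  have [rho prod_w] := prod_p w gw; have [_ p1] := dp w.
  exact: fibre_prob gw prod_w p1.
(* A non-recurrent [w] lies in a null fibre, where both sides of the identity vanish. *)
have z : P (~` [set w | recurrent w]) = 0%E.
  by apply/negligibleP; [exact/measurableC/recurrent_measurable|exact: recurrent_ae].
have sub : observation nu k @^-1` [set observation nu k w] `<=` ~` [set w | recurrent w].
  by move=> w' /esym/(observation_bad bw).
have mO := observation_measurable nu k (observation nu k w).
rewrite (subset_measure0 _ _ sub z) //; last exact/measurableC/recurrent_measurable.
rewrite mule0; apply: subset_measure0 z => //.
- apply: measurableI => //; exact: node_action_measurable (fun x => alpha x = i) k.
- exact/measurableC/recurrent_measurable.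
- by move=> w' [/sub].
Qed.

End HiddenPart.

End Node.
End Run.

(** * Self-play and the two decision problems at a state *)

Section Plays.
Variables (R : realType) (G : game R) (A : algorithm R).
Variables (d : measure_display) (T : measurableType d) (P : probability T R).
Variables (F : nat -> set (set T)) (c : nat -> T -> choices G).
Hypothesis run : search_run A P F c.
Variable h : inner G.
Hypothesis recurrent_ae : {ae P, forall w, recurrent c h w}.

Let act := node_action c h.
Let act1 k w := (act k w).1.
Let act2 k w := (act k w).2.
Let pay k w i j := @node_payoff _ _ _ _ c h k w i j.
Let pay1 k w i := pay k w i (act2 k w).
Let pay2 k w j := 1 - pay k w (act1 k w) j.
Let tau w k := visit_time (c ^~ w) h k.

Lemma own_history1 k w : recurrent c h w ->
  own_history pay1 act1 k w = hist1 (state_after (c ^~ w) (tau w k) h).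
Proof.
move=> gw; have [-> _ _] := node_history (c ^~ w) (tau w k) h.
have [-> _] := visit_timeP k gw; apply: eq_map => s.
by rewrite /pay1 /pay /act1 /act2 /act /node_payoff /node_action asboolT.
Qed.

Lemma own_history2 k w : recurrent c h w ->
  own_history pay2 act2 k w = hist2 (state_after (c ^~ w) (tau w k) h).
Proof.
move=> gw; have [_ -> _] := node_history (c ^~ w) (tau w k) h.
have [-> _] := visit_timeP k gw; apply: eq_map => s.
by rewrite /pay2 /pay /act1 /act2 /act /node_payoff /node_action asboolT.
Qed.

Lemma own_history_observation (nu : 'I_(nact1 h) * 'I_(nact2 h) -> 'I_(nact1 h) * 'I_(nact2 h)) k w w' :
  observation c nu k w = observation c nu k w' ->
  own_history pay1 act1 k w = own_history pay1 act1 k w' /\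
  own_history pay2 act2 k w = own_history pay2 act2 k w'.
Proof.
move=> e; have ea s : (s < k)%N -> act s w = act s w'.
  by move=> lt; apply: node_action_before e.
have ep s : (s < k)%N -> pay s w = pay s w'.
  by move=> /ltnW le; apply: node_payoff_observation (observation_mono le e).
split; apply/eq_in_map => s; rewrite mem_iota add0n => /andP[_ lt];
  by rewrite /pay1 /pay2 /act1 /act2 ep ?ea.
Qed.

(** [nu0] hides the whole joint action, for self-play. [nu1] hides only the action of player 1: in
    the decision problem of that player the opponent's action enters the payoffs, so it must be
    known before the draw. [nu2] is symmetric. *)
Let nu0 (x : 'I_(nact1 h) * 'I_(nact2 h)) := (Ordinal (nact1_gt0 h), Ordinal (nact2_gt0 h)).
Let nu1 (x : 'I_(nact1 h) * 'I_(nact2 h)) := (Ordinal (nact1_gt0 h), x.2).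
Let nu2 (x : 'I_(nact1 h) * 'I_(nact2 h)) := (x.1, Ordinal (nact2_gt0 h)).

Lemma node_self_play : self_play A P pay act1 act2 (node_filtration c nu0).
Proof.
split.
- exact (node_filtrationP run nu0).
- by move=> s w i j; exact: node_payoff_01.
- by move=> s i j Y mY w w' e; rewrite /= /pay (node_payoff_observation e).
- move=> s i j w w' e.
  by rewrite /= /act1 /act2 /act (node_action_before (ltnSn s) e).
move=> s i j.
have -> : [set w | act1 s w = i /\ act2 s w = j] = [set w | act s w = (i, j)].
  apply/seteqP; split=> w; rewrite /= /act1 /act2; first by case: (act s w) => a b /= [-> ->].
  by move=> ->.
pose p w (x : 'I_(nact1 h) * 'I_(nact2 h)) :=
  A _ (own_history pay1 act1 s w) x.1 * A _ (own_history pay2 act2 s w) x.2.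
apply: (node_cond_prob run recurrent_ae (nu := nu0) (alpha := id) (ups := fun _ x => x)
  (p := p) _ _ _ (i, j)) => //.
- move=> w; have [p1 q1] := choice_prob_distr A (own_history pay1 act1 s w) (nact1_gt0 h).
  have [p2 q2] := choice_prob_distr A (own_history pay2 act2 s w) (nact2_gt0 h).
  split=> [x|]; first by rewrite mulr_ge0.
  rewrite -(pair_bigA _ (fun a b => A _ (own_history pay1 act1 s w) a *
    A _ (own_history pay2 act2 s w) b)) /=.
  by under eq_bigr do rewrite -mulr_sumr q2 mulr1.
- by move=> w w' /own_history_observation[e1 e2]; rewrite /p e1 e2.
- move=> w gw; exists (fun _ => 1) => x y; rewrite mulr1 /p own_history1 //.
  by rewrite own_history2.
Qed.

(** The joint law is a product, so given the action of player 2 that of player 1 still follows [A];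
    the factor of player 2 plays the part of [rho]. *)
Lemma node_decision_play1 : decision_play A P pay1 act1 (node_filtration c nu1).
Proof.
have e2 s w w' : observation c nu1 s w = observation c nu1 s w' -> act2 s w = act2 s w'.
  by move=> /node_action_retained[].
split.
- exact (node_filtrationP run nu1).
- by move=> s w i; exact: node_payoff_01.
- move=> s i Y mY w w' e.
  by rewrite /= /pay1 (e2 _ _ _ e) /pay (node_payoff_observation e).
- by move=> s i w w' e; rewrite /= /act1 /act (node_action_before (ltnSn s) e).
move=> s i; apply: (node_cond_prob run recurrent_ae (nu := nu1) (alpha := fst)
  (ups := fun x a => (a, x.2)) (p := fun w => A _ (own_history pay1 act1 s w)) _ _ _ i) => //.
- by move=> [a b] [a' b'] /= [->].
- by move=> w; apply: choice_prob_distr; rewrite nact1_gt0.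
- by move=> w w' /own_history_observation[-> _].
- move=> w gw; exists (fun x => A _ (hist2 (state_after (c ^~ w) (tau w s) h)) x.2) => x a.
  by rewrite own_history1.
Qed.

Lemma node_decision_play2 : decision_play A P pay2 act2 (node_filtration c nu2).
Proof.
have e1 s w w' : observation c nu2 s w = observation c nu2 s w' -> act1 s w = act1 s w'.
  by move=> /node_action_retained[].
split.
- exact (node_filtrationP run nu2).
- move=> s w j; have := node_payoff_01 c s w (act1 s w) j.
  by rewrite /pay2 /pay; lra.
- move=> s j Y mY w w' e.
  by rewrite /= /pay2 (e1 _ _ _ e) /pay (node_payoff_observation e).
- by move=> s j w w' e; rewrite /= /act2 /act (node_action_before (ltnSn s) e).
move=> s j; apply: (node_cond_prob run recurrent_ae (nu := nu2) (alpha := snd)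
  (ups := fun x b => (x.1, b)) (p := fun w => A _ (own_history pay2 act2 s w)) _ _ _ j) => //.
- by move=> [a b] [a' b'] /= [->].
- by move=> w; apply: choice_prob_distr; rewrite nact2_gt0.
- by move=> w w' /own_history_observation[_ ->].
- move=> w gw; exists (fun x => A _ (hist1 (state_after (c ^~ w) (tau w s) h)) x.1) => x b.
  by rewrite own_history2 //= mulrC.
Qed.

(** Self-play at [h] selects the joint action leading to [g] infinitely often, and each such
    selection is a visit to [g]. *)
Lemma child_recurrent g : guaranteed_exploration A -> child h g ->
  {ae P, forall w, recurrent c g w}.
Proof.
move=> GE /childP[i [j ij]]; apply: filterS2 recurrent_ae (GE _ _ _ _ _ _ _ _ _ node_self_play).
move=> w gw /(_ i j)/cvgnyPge cvg k.
have [n _ /(_ n (leqnn n)) kn] := cvg k.+1.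
have [Vn _] := visit_timeP n gw.
have := nvisits_child (c ^~ w) (tau w n) ij; rewrite /tau Vn => le.
have : (k < nvisits (c ^~ w) (tau w n) g)%N.
  apply: leq_trans le; apply: leq_trans kn _; rewrite /joint_count.
  by apply: sub_count => s /=; rewrite /act1 /act2 /act /node_action asboolT //.
(* Nothing is visited at time [0], so the time is a successor, as in [visited_io]. *)
by case: (tau w n) => [//|t]; exists t.
Qed.

Lemma node_regret1 eps : hannan_consistent eps A -> {ae P, forall w, forall e : R, 0 < e ->
  \forall n \near \oo, forall i,
    n%:R^-1 * \sum_(k < n) visit_payoff (c ^~ w) k i (visit_choice (c ^~ w) h k).2 <=
    n%:R^-1 * \sum_(k < n) visit_reward (c ^~ w) h k + eps + e}.
Proof.
move=> HC; apply: filterS2 recurrent_ae (HC _ _ _ _ _ _ _ node_decision_play1) => w gw le e e0.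
apply: filterS (limn_esup_near e0 le) => n; rewrite /regret => reg i.
have payE s a : pay1 s w a = visit_payoff (c ^~ w) s a (visit_choice (c ^~ w) h s).2.
  by rewrite /pay1 /pay /act2 /act /node_payoff /node_action asboolT.
have actE s : act1 s w = (visit_choice (c ^~ w) h s).1.
  by rewrite /act1 /act /node_action asboolT.
have := le_bigmax 0 (fun i => n%:R^-1 * \sum_(s < n) pay1 s w i) i.
move: reg; under [X in _ - _ * X <= _]eq_bigr do rewrite payE actE.
rewrite /= -/(visit_reward _ _ _); under [X in _ * X <= _]eq_bigr do rewrite payE.
rewrite /visit_reward; lra.
Qed.

(** With payoffs [1 - x] the constant cancels in the regret and the inequality is reversed. *)
Lemma node_regret2 eps : hannan_consistent eps A -> {ae P, forall w, forall e : R, 0 < e ->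
  \forall n \near \oo, forall j,
    n%:R^-1 * \sum_(k < n) visit_reward (c ^~ w) h k - eps - e <=
    n%:R^-1 * \sum_(k < n) visit_payoff (c ^~ w) k (visit_choice (c ^~ w) h k).1 j}.
Proof.
move=> HC; apply: filterS2 recurrent_ae (HC _ _ _ _ _ _ _ node_decision_play2) => w gw le e e0.
apply: filterS (limn_esup_near e0 le) => n; rewrite /regret => reg j.
have payE s b : pay2 s w b = 1 - visit_payoff (c ^~ w) s (visit_choice (c ^~ w) h s).1 b.
  by rewrite /pay2 /pay /act1 /act /node_payoff /node_action asboolT.
have actE s : act2 s w = (visit_choice (c ^~ w) h s).2.
  by rewrite /act2 /act /node_action asboolT.
have := le_bigmax 0 (fun j => n%:R^-1 * \sum_(s < n) pay2 s w j) j.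
move: reg; under [X in _ - _ * X <= _]eq_bigr do rewrite payE actE.
rewrite /=; under [X in _ * X <= _]eq_bigr do rewrite payE.
rewrite !sumrB !mulrBr /visit_reward; lra.
Qed.

End Plays.

(** Induction along the path from the root, which every simulation visits. *)
Lemma all_recurrent (R : realType) (G : game R) (A : algorithm R)
    (d : measure_display) (T : measurableType d) (P : probability T R)
    (F : nat -> set (set T)) (c : nat -> T -> choices G) h :
  guaranteed_exploration A -> search_run A P F c -> {ae P, forall w, recurrent c h w}.
Proof.
move=> GE run; have [p [pp <- _]] := level_path h.
elim/last_ind: p pp => [_|p x IHp].
  by apply: nearW => w k; exists k; rewrite nvisits_root.
rewrite last_rcons rcons_path => /andP[pp cx].
exact: (child_recurrent run (IHp pp) GE cx).
Qed.

Theorem theorem4p11 (R : realType) (G : game R) (eps : R) (A : algorithm R)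
    (d : measure_display) (T : measurableType d) (P : probability T R)
    (F : nat -> set (set T)) (c : nat -> T -> choices G)
    (heps : 0 < eps)
    (hHC : hannan_consistent eps A)
    (hGE : guaranteed_exploration A)
    (hrun : search_run A P F c)
    (delta : R) (hdelta : 0 < delta) :
  {ae P, forall w, exists t0 : nat, forall t : nat, (t0 <= t)%N ->
     forall (s1 : forall h : inner G, 'I_(nact1 h) -> R)
            (s2 : forall h : inner G, 'I_(nact2 h) -> R),
       empirical1 (state_after (c ^~ w) t) s1 ->
       empirical2 (state_after (c ^~ w) t) s2 ->
       subgame_perfect_eps_nash ((2 * (depth G)%:R ^+ 2 + delta) * eps) s1 s2}.
Proof.
have io h := all_recurrent h hGE hrun.
(* There are finitely many states, so their almost sure events hold together; the rest concerns a
   single run. *)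
apply: filterS3 (filter_forall _ io)
  (filter_forall _ (fun h => node_regret1 hrun (io h) hHC))
  (filter_forall _ (fun h => node_regret2 hrun (io h) hHC)) => w gw r1 r2.
have [t0 _ Ht0] := near_subgame_perfect (ltW heps) gw r1 r2 heps hdelta.
by exists t0 => t /Ht0; apply.
Qed.
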